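(* Let $M$ be a pointed compact metric space. The following assertions are equivalent: (i) $M$ is geodesic. (ii) For every $x,y\in M$ with $x\neq y$ there is $z\in[x,y]\setminus\{x,y\}$. (iii) $\mathrm{Lip}_0(M)$ has the Daugavet property. (iv) The unit ball of $\mathcal F(M)$ does not have any preserved extreme point. (v) The unit ball of $\mathcal F(M)$ does not have any strongly exposed point. (vi) The norm of $\mathrm{Lip}_0(M)$ does not have any point of Gâteaux differentiability. (vii) The norm of $\mathrm{Lip}_0(M)$ does not have any point of Fréchet differentiability.
   Context: All Banach spaces are real; $B_X$, $S_X$ are the closed unit ball and unit sphere of $X$. A pointed metric space is a metric space $(M,d)$ with a distinguished point $0\in M$. $\mathrm{Lip}_0(M)$ is the Banach space of all Lipschitz functions $f\colon M\to\mathbb R$ with $f(0)=0$, normed by the Lipschitz constant. The Lipschitz free space is $\mathcal F(M)=\overline{\mathrm{span}}\{\delta_x:x\in M\}\subset \mathrm{Lip}_0(M)^*$, where $\delta_x(f)=f(x)$; one has $\mathcal F(M)^*=\mathrm{Lip}_0(M)$ isometrically. $M$ is a geodesic space if for every $x,y\in M$ the distance $d(x,y)$ equals the infimum of the lengths of rectifiable curves in $M$ joining $x$ and $y$, and this infimum is attained. For $x\neq y\in M$ the metric segment is $[x,y]:=\{z\in M: d(x,z)+d(z,y)=d(x,y)\}$. A Banach space $X$ has the Daugavet property if every bounded rank-one operator $T\colon X\to X$ satisfies $\|T+I\|=1+\|T\|$, where $I$ is the identity operator. A preserved extreme point of $B_{\mathcal F(M)}$ is an element of $\mathcal F(M)$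 (canonically embedded in $\mathrm{Lip}_0(M)^*=\mathcal F(M)^{**}$) which is an extreme point of $B_{\mathrm{Lip}_0(M)^*}$. A point $x\in S_X$ is a strongly exposed point of $B_X$ if there is $f\in S_{X^*}$ such that every sequence $\{x_n\}$ in $B_X$ with $\lim_n f(x_n)=f(x)$ is norm convergent to $x$.
   Formalization: The formal theorem assumes that M has at least two points; for a one-point M, Lip_0(M) and F(M) are zero, so (i) and (ii) hold while (iv), (vi) and (vii) fail, and the equivalence as stated is false. *)

(* Defs.v *)
From HB Require Import structures.
From mathcomp Require Import all_boot all_order all_algebra.
From mathcomp Require Import all_classical all_reals all_analysis.

Set Implicit Arguments.
Unset Strict Implicit.
Unset Printing Implicit Defensive.

Import Order.TTheory GRing.Theory Num.Theory.
Import numFieldNormedType.Exports.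

Local Open Scope classical_set_scope.
Local Open Scope ring_scope.

Section bounded_operators.
Context {R : realType} (X Y : normedModType R).

Definition blin : {pred X -> Y} :=
  mem [set T : X -> Y | linear T /\ continuous T].

Lemma blin_submod_closed : submod_closed blin.
Proof.
split=> [|a S T].
  rewrite inE; split=> [b x y|]; last by move=> x; exact: cvg_cst.
  by rewrite [RHS]addr0 [RHS]scaler0.
rewrite !inE => -[lS cS] [lT cT]; split=> [b x y|x].
  rewrite -[LHS]/(a *: S _ + T _) lS lT !scalerDr !scalerA (mulrC a b) -!addrA.
  by congr (_ + _); rewrite addrCA.
by apply: cvgD; [apply: cvgZr; exact: cS|exact: cT].
Qed.
HB.instance Definition _ :=
  GRing.isSubmodClosed.Build R (X -> Y) blin blin_submod_closed.

Record blinType := Blin { blin_fun :> X -> Y ; _ : blin_fun \in blin }.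

HB.instance Definition _ := [isSub for blin_fun].
HB.instance Definition _ := [Choice of blinType by <:].
HB.instance Definition _ := [SubChoice_isSubLmodule of blinType by <:].

Lemma blin_continuous (T : blinType) : continuous T.
Proof. by case: T => T /= /[!inE] -[]. Qed.

Lemma blin_linear (T : blinType) : linear T.
Proof. by case: T => T /= /[!inE] -[]. Qed.

HB.instance Definition _ (T : blinType) :=
  GRing.isLinear.Build R X Y *:%R T (@blin_linear T).

Lemma blin_bound (T : blinType) :
  exists2 k, 0 <= k & forall x, `|T x| <= k * `|x|.
Proof.
have /linear_boundedP/pinfty_ex_gt0[k k0 kT] : bounded_near T (nbhs (0 : X)).
  by apply: continuous_linear_bounded; exact: blin_continuous.
by exists k => //; exact: ltW.
Qed.

Definition blin_norm (T : blinType) : R :=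
  sup [set `|T x| | x in [set x : X | `|x| <= 1]].

Lemma blin_norm_has_sup (T : blinType) :
  has_sup [set `|T x| | x in [set x : X | `|x| <= 1]].
Proof.
split; first by exists `|T 0|, 0 => //=; rewrite normr0.
have [k k0 kT] := blin_bound T; exists k => _ [x /= x1 <-].
by rewrite (le_trans (kT x))// ler_piMr.
Qed.

Lemma blin_norm_ub (T : blinType) x : `|x| <= 1 -> `|T x| <= blin_norm T.
Proof.
move=> x1; apply: (ub_le_sup (blin_norm_has_sup T).2).
by exists x.
Qed.

Lemma blin_norm_le (T : blinType) k :
  (forall x, `|x| <= 1 -> `|T x| <= k) -> blin_norm T <= k.
Proof.
move=> kT; apply: ge_sup; first exact: (blin_norm_has_sup T).1.
by move=> _ [x /= x1 <-]; exact: kT.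
Qed.

Lemma ler_blin_norm (T : blinType) x : `|T x| <= blin_norm T * `|x|.
Proof.
have [->|x0] := eqVneq x 0; first by rewrite linear0 !normr0 mulr0.
have nx : 0 < `|x| by rewrite normr_gt0.
rewrite -ler_pdivrMr// mulrC -[X in X * _]ger0_norm ?invr_ge0//.
rewrite -normrZ -linearZ/=; apply: blin_norm_ub.
by rewrite normrZ ger0_norm ?invr_ge0// mulVf// gt_eqF.
Qed.

Let blin_normD (S T : blinType) : blin_norm (S + T) <= blin_norm S + blin_norm T.
Proof.
apply: blin_norm_le => x x1; apply: (le_trans (ler_normD (S x) (T x))).
by apply: lerD; exact: blin_norm_ub.
Qed.

Let blin_normZ (a : R) (T : blinType) : blin_norm (a *: T) = `|a| * blin_norm T.
Proof.
apply/eqP; rewrite eq_le; apply/andP; split.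
  apply: blin_norm_le => x x1; rewrite [X in `|X|](_ : _ = a *: T x)// normrZ.
  by rewrite ler_wpM2l//; exact: blin_norm_ub.
have [->|a0] := eqVneq a 0.
  rewrite normr0 mul0r (le_trans _ (@blin_norm_ub _ 0 _))//.
  by rewrite normr0.
have na : 0 < `|a| by rewrite normr_gt0.
rewrite -ler_pdivlMl//; apply: blin_norm_le => x x1.
rewrite ler_pdivlMl// -normrZ.
exact: (@blin_norm_ub (a *: T)).
Qed.

Let blin_norm0_eq0 (T : blinType) : blin_norm T = 0 -> T = 0.
Proof.
move=> T0; apply/val_inj/funext => x /=.
apply/eqP; rewrite -normr_le0 (le_trans (ler_blin_norm T x))//.
by rewrite T0 mul0r.
Qed.

HB.instance Definition _ := Lmodule_isNormed.Build R blinType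
  blin_normD blin_normZ blin_norm0_eq0.

End bounded_operators.
Arguments blin {R} X Y.

Definition dual (R : realType) (X : normedModType R) := blinType X R^o.
HB.instance Definition _ (R : realType) (X : normedModType R) :=
  NormedModule.on (dual X).

Section identity.
Context {R : realType} (X : normedModType R).

Lemma blin_id_subproof : (idfun : X -> X) \in blin X X.
Proof. by rewrite inE; split=> // x; exact: cvg_id. Qed.

Definition blin_id : blinType X X := Blin blin_id_subproof.

End identity.

Section banach_notions.
Context {R : realType}.

Definition rank_one (X Y : normedModType R) (T : blinType X Y) :=
  exists2 y : Y, y != 0 & range T = range (fun c : R => c *: y).

Definition daugavet_property (X : normedModType R) :=
  forall T : blinType X X, rank_one T -> `|T + blin_id X| = 1 + `|T|.

Definition extreme_point (V : lmodType R) (A : set V) (x : V) :=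
  A x /\ forall (y z : V) (t : R), A y -> A z -> 0 < t < 1 ->
    x = t *: y + (1 - t) *: z -> y = x /\ z = x.

Definition unit_ball (X : normedModType R) : set X := [set x | `|x| <= 1].
Arguments unit_ball : clear implicits.

Definition unit_sphere (X : normedModType R) : set X := [set x | `|x| = 1].
Arguments unit_sphere : clear implicits.

Definition strongly_exposed_point (X : normedModType R) (x : X) :=
  unit_sphere X x /\
  exists2 f : dual X, unit_sphere (dual X) f &
    forall u : nat -> X, (forall n, unit_ball X (u n)) ->
      f (u n) @[n --> \oo] --> f x -> u @ \oo --> x.

Definition gateaux_differentiable (X Y : normedModType R) (g : X -> Y) (x : X) :=
  exists L : blinType X Y, forall v : X, is_derive x v g (L v).

Definition norm_fun (X : normedModType R) : X -> R^o := fun x => `|x|.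

End banach_notions.
Arguments unit_ball {R} X _.
Arguments unit_sphere {R} X _.
Arguments norm_fun {R} X _.

Section lip0.
Context {R : realType} {M : metricType R} (o : M).

Definition lip0 : {pred M -> R^o} := mem [set f : M -> R^o |
  f o = 0 /\ exists k : R, forall x y, `|f x - f y| <= k * mdist x y].

Lemma lip0_submod_closed : submod_closed lip0.
Proof.
split=> [|a f g].
  rewrite inE; split=> //; exists 0 => x y.
  by rewrite -[X in `|X|]/(0 - 0) subrr normr0 mul0r.
rewrite !inE => -[f0 [k kf]] [g0 [l lg]]; split.
  by rewrite -[LHS]/(a *: f o + g o) f0 g0 scaler0 addr0.
exists (`|a| * k + l) => x y.
rewrite -[X in `|X|]/((a *: f x + g x) - (a *: f y + g y)).
rewrite opprD addrACA -scalerBr (le_trans (ler_normD _ _))// mulrDl.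
by rewrite lerD// normrZ -mulrA ler_wpM2l.
Qed.
HB.instance Definition _ :=
  GRing.isSubmodClosed.Build R (M -> R^o) lip0 lip0_submod_closed.

Record Lip0 := MkLip0 { lip0_fun :> M -> R^o ; _ : lip0_fun \in lip0 }.

HB.instance Definition _ := [isSub for lip0_fun].
HB.instance Definition _ := [Choice of Lip0 by <:].
HB.instance Definition _ := [SubChoice_isSubLmodule of Lip0 by <:].

Lemma lip0_base (f : Lip0) : f o = 0.
Proof. by case: f => f /= /[!inE] -[]. Qed.

Lemma lip0_lip (f : Lip0) :
  exists k : R, forall x y, `|f x - f y| <= k * mdist x y.
Proof. by case: f => f /= /[!inE] -[]. Qed.

Definition slopes (f : Lip0) : set R :=
  [set `|f p.1 - f p.2| / mdist p.1 p.2 | p in [set p : M * M | p.1 != p.2]].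

(* If M is a single point, there are no slopes and sup set0 = 0. *)
Definition lip_norm (f : Lip0) : R := sup (slopes f).

Lemma lip_norm_slope (f : Lip0) x y :
  x != y -> `|f x - f y| / mdist x y <= lip_norm f.
Proof.
move=> xy; apply: ub_le_sup; last by exists (x, y).
have [k kf] := lip0_lip f; exists k => _ [[u v] /= uv <-].
by rewrite ler_pdivrMr ?mdist_gt0.
Qed.

Lemma ler_lip_norm (f : Lip0) x y : `|f x - f y| <= lip_norm f * mdist x y.
Proof.
have [->|xy] := eqVneq x y; first by rewrite mdistxx subrr normr0 mulr0.
by rewrite -ler_pdivrMr ?mdist_gt0//; exact: lip_norm_slope.
Qed.

Lemma lip_norm_ge0 (f : Lip0) : 0 <= lip_norm f.
Proof.
have [f0|/set0P[r [[x y] /= xy _]]] := eqVneq (slopes f) set0.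
  by rewrite /lip_norm f0 sup0.
by apply: le_trans (lip_norm_slope f xy); rewrite divr_ge0// mdist_ge0.
Qed.

Lemma lip_norm_le (f : Lip0) k : 0 <= k ->
  (forall x y, `|f x - f y| <= k * mdist x y) -> lip_norm f <= k.
Proof.
move=> k0 kf; rewrite /lip_norm.
have [->|/set0P slopes0] := eqVneq (slopes f) set0; first by rewrite sup0.
apply: ge_sup => // _ [[x y] /= xy <-].
by rewrite ler_pdivrMr ?mdist_gt0.
Qed.

Let lip_normD (f g : Lip0) : lip_norm (f + g) <= lip_norm f + lip_norm g.
Proof.
apply: lip_norm_le => [|x y]; first by rewrite addr_ge0 ?lip_norm_ge0.
rewrite [X in `|X|](_ : _ = (f x - f y) + (g x - g y)); last first.
  by rewrite addrACA -opprD.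
by rewrite (le_trans (ler_normD _ _))// mulrDl lerD// ler_lip_norm.
Qed.

Let lip_normZ (a : R) (f : Lip0) : lip_norm (a *: f) = `|a| * lip_norm f.
Proof.
have aE x y : (a *: f) x - (a *: f) y = a *: (f x - f y) :> R^o.
  by rewrite scalerBr.
apply/eqP; rewrite eq_le; apply/andP; split.
  apply: lip_norm_le => [|x y]; first by rewrite mulr_ge0 ?lip_norm_ge0.
  by rewrite aE normrZ -mulrA ler_wpM2l// ler_lip_norm.
have [->|a0] := eqVneq a 0; first by rewrite normr0 mul0r lip_norm_ge0.
have na : 0 < `|a| by rewrite normr_gt0.
rewrite -ler_pdivlMl//; apply: lip_norm_le => [|x y].
  by rewrite mulr_ge0 ?invr_ge0 ?lip_norm_ge0.
by rewrite -mulrA ler_pdivlMl// -normrZ -aE ler_lip_norm.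
Qed.

Let lip_norm0_eq0 (f : Lip0) : lip_norm f = 0 -> f = 0.
Proof.
move=> f0; apply/val_inj/funext => x /=; apply/eqP.
by have := ler_lip_norm f x o; rewrite f0 mul0r lip0_base subr0 normr_le0.
Qed.

HB.instance Definition _ := Lmodule_isNormed.Build R Lip0
  lip_normD lip_normZ lip_norm0_eq0.

Lemma delta_subproof (x : M) : (fun f : Lip0 => f x) \in blin Lip0 R^o.
Proof.
rewrite inE.
have lin : linear ((fun f : Lip0 => f x) : Lip0 -> R^o) by [].
pose L := GRing.isLinear.Build R Lip0 R^o *:%R _ lin.
pose h : {linear Lip0 -> R^o} := HB.pack (fun f : Lip0 => f x : R^o) L.
split=> //; apply: (@bounded_linear_continuous R Lip0 R^o h).
apply/linear_boundedP; near=> r => f /=.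
have := ler_lip_norm f x o; rewrite lip0_base subr0 => /le_trans; apply.
by rewrite mulrC ler_wpM2r ?lip_norm_ge0.
Unshelve. all: by end_near. Qed.

Definition delta (x : M) : dual Lip0 := Blin (delta_subproof x).

Definition lin_span (V : lmodType R) (A : set V) : set V :=
  [set v | exists (n : nat) (a : 'I_n -> R) (w : 'I_n -> V),
     (forall i, A (w i)) /\ v = \sum_(i < n) a i *: w i].

Definition free_carrier : {pred dual Lip0} := mem (closure (lin_span (range delta))).

Lemma lin_span_lin (V : lmodType R) (A : set V) (a : R) (u v : V) :
  lin_span A u -> lin_span A v -> lin_span A (a *: u + v).
Proof.
move=> [m [b [w [Aw ->]]]] [n [c [z [Az ->]]]].
exists (m + n)%N, (fun i => match fintype.split i with inl j => a * b j | inr j => c j end).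
exists (fun i => match fintype.split i with inl j => w j | inr j => z j end).
split; first by move=> i; case: fintype.split.
rewrite big_split_ord scaler_sumr; congr (_ + _); apply: eq_bigr => i _.
  by rewrite (unsplitK (inl i)) scalerA.
by rewrite (unsplitK (inr i)).
Qed.

Lemma free_submod_closed : submod_closed free_carrier.
Proof.
split=> [|a u v].
  rewrite inE; apply: subset_closure; exists 0%N, (fun=> 0), (fun=> 0).
  by split=> [[]//|]; rewrite big_ord0.
rewrite !inE => Fu Fv B.
have ct : (fun p : dual Lip0 * dual Lip0 => a *: p.1 + p.2) @ (u, v)
    --> a *: u + v.
  apply: cvgD; last exact: cvg_snd.
  by apply: cvgZr; exact: cvg_fst.
move=> /ct [[/= U V] [uU vV] UVB].
have [u' [Su' Uu']] := Fu _ uU; have [v' [Sv' Vv']] := Fv _ vV.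
exists (a *: u' + v'); split; first exact: lin_span_lin.
exact: (UVB (u', v')).
Qed.
HB.instance Definition _ :=
  GRing.isSubmodClosed.Build R (dual Lip0) free_carrier free_submod_closed.

Record FreeSpace :=
  MkFreeSpace { free_val :> dual Lip0 ; _ : free_val \in free_carrier }.

HB.instance Definition _ := [isSub for free_val].
HB.instance Definition _ := [Choice of FreeSpace by <:].
HB.instance Definition _ := [SubChoice_isSubLmodule of FreeSpace by <:].

Definition free_norm (m : FreeSpace) : R := `|free_val m|.

Let free_normD (m n : FreeSpace) : free_norm (m + n) <= free_norm m + free_norm n.
Proof. exact: ler_normD. Qed.

Let free_normZ (a : R) (m : FreeSpace) : free_norm (a *: m) = `|a| * free_norm m.
Proof. exact: normrZ. Qed.

Let free_norm0_eq0 (m : FreeSpace) : free_norm m = 0 -> m = 0.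
Proof. by move=> /normr0_eq0 m0; exact: val_inj. Qed.

HB.instance Definition _ := Lmodule_isNormed.Build R FreeSpace
  free_normD free_normZ free_norm0_eq0.

(* dual Lip0 is isometric to the bidual of FreeSpace, and free_val is then the
   canonical embedding. *)
Definition preserved_extreme_point (m : FreeSpace) :=
  extreme_point (unit_ball (dual Lip0)) (free_val m).

End lip0.

Section geodesic.
Context {R : realType} (M : metricType R).

Definition metric_segment (x y : M) : set M :=
  [set z | mdist x z + mdist z y = mdist x y].

(* Metric-valued analogue of variation and total_variation on [0, 1]: as in
   itv_partition, the list s omits the left endpoint 0. *)
Definition curve_variation (g : R -> M) (s : seq R) : R :=
  let G := g \o nth 1 (0 :: s) in
  \sum_(0 <= n < size s) mdist (G n) (G n.+1).

Definition curve_length (g : R -> M) : \bar R :=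
  ereal_sup [set (curve_variation g s)%:E | s in itv_partition 0 1].

Definition rectifiable_curves (x y : M) : set (R -> M) :=
  [set g : R -> M | [/\ {within `[(0 : R), 1], continuous g}, g 0 = x, g 1 = y &
               (curve_length g < +oo)%E]].

Definition geodesic := forall x y : M,
  let lengths := [set curve_length g | g in rectifiable_curves x y] in
  (mdist x y)%:E = ereal_inf lengths /\ lengths (ereal_inf lengths).

End geodesic.

(* Main.v *)
(** If some pair [x, y] has no point strictly between, compactness yields a pair
    and [e > 0] with [d x z + d z y >= d x y + e min (d x z) (d z y)] for all
    [z]: otherwise a pair at minimal distance could be shortened repeatedly,
    always losing almost nothing of [d x y], until it produces a point between
    [x] and [y]. For such a pair the difference [f] of two steep bumps at [x]
    and [y] satisfies [|f + h| = 1 + (h x - h y) / d x y] for all small [h]. A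
    norm that is affine near [f] is Frechet differentiable there, its derivative
    is strongly exposed and extreme in the dual ball, and [g |-> g - L(g) f] has
    norm less than 2.

    If conversely [M] is metrically convex, any two points are joined by an
    isometric segment (Menger), so every Lipschitz function almost attains its
    norm at pairs [(u_n, v_n)] lying in disjoint balls that shrink to a point and
    are large compared with [d u_n v_n]. Some [h] has slopes alternately 1 and 0
    at these pairs, which excludes Gateaux differentiability (Smulyan) and
    strongly exposed points. Changing [f] in the n-th ball so that its slope at
    [(u_n, v_n)] is 1, and averaging over n, moves [f] very little: this gives
    the Daugavet property. Finally, an extreme functional [m] of the dual ball
    concentrates at one point [(u, v)] of [M * M] (Milman). If [u = v], then [m]
    is not a nonzero element of the free space, whose elements are nearly
    determined by finitely many values of [f]; otherwise [m] is a multiple of the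
    molecule of [(u, v)], a convex combination of molecules through any point
    between [u] and [v]. *)
Require Import Defs.
From HB Require Import structures.
From mathcomp Require Import all_boot all_order all_algebra.
From mathcomp Require Import all_classical all_reals all_analysis.
From mathcomp Require Import ring lra.

Set Implicit Arguments.
Unset Strict Implicit.
Unset Printing Implicit Defensive.

Import Order.TTheory GRing.Theory Num.Theory.
Import numFieldNormedType.Exports.

Local Open Scope classical_set_scope.
Local Open Scope ring_scope.

(** * Metric convexity *)

Section metric_facts.
Context {R : realType} (M : metricType R).
Implicit Types x y z : M.

Lemma mdist_lipschitz x y x' y' :
  `|mdist x y - mdist x' y'| <= mdist x x' + mdist y y'.
Proof.
have := metric_triangle x x' y; have := metric_triangle x' y' y.
have := metric_triangle x' x y'; have := metric_triangle x y y'.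
rewrite (metric_sym y' y) (metric_sym x' x) ler_norml.
by move=> *; apply/andP; split; lra.
Qed.

Lemma nbhs_mdist x e : 0 < e -> nbhs x [set z | mdist x z < e].
Proof. by move=> e0; rewrite -ballEmdist; exact: nbhsx_ballx. Qed.

Lemma mdist_continuous : continuous (fun p : M * M => mdist p.1 p.2).
Proof.
move=> [x y]; apply/cvgrPdist_lt => e e0.
have e2 : 0 < e / 2 by rewrite divr_gt0.
exists ([set z | mdist x z < e / 2], [set z | mdist y z < e / 2]).
  by split; exact: nbhs_mdist.
move=> [a b] [/= xa yb].
by apply: le_lt_trans (mdist_lipschitz _ _ _ _) _; lra.
Qed.

Lemma mdistr_continuous x : continuous (mdist x).
Proof.
move=> y; apply/cvgrPdist_lt => e e0; near=> z.
apply: le_lt_trans (mdist_lipschitz _ _ _ _) _; rewrite mdistxx add0r.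
by near: z; exact: nbhs_mdist.
Unshelve. all: by end_near. Qed.

Definition segments := forall x y, exists g : R -> M, [/\ g 0 = x, g 1 = y &
  forall s t, 0 <= s <= 1 -> 0 <= t <= 1 ->
    mdist (g s) (g t) = `|s - t| * mdist x y].

Definition metrically_convex := forall x y, x != y ->
  (metric_segment x y `\` [set x; y]) !=set0.

(** For [e > 0], a uniform version of the absence of points strictly between [x] and [y]: a detour
    through [z] costs a fixed fraction of the distance from [z] to the nearer end. *)
Definition isolated_pair x y e := forall z,
  mdist x y + e * Num.min (mdist x z) (mdist z y) <= mdist x z + mdist z y.

(* The pair is found by minimising [mdist u v] over the compact set [K] below. *)
Lemma isolated_pair_exists : compact [set: M] -> ~ metrically_convex ->
  exists x y (e : R), [/\ x != y, 0 < e, e <= 1 & isolated_pair x y e].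
Proof.
move=> Mc /existsNP[x /existsNP[y /not_implyP[xy seg0]]].
have segE z : mdist x z + mdist z y <= mdist x y -> z = x \/ z = y.
  move=> le; apply: contrapT => zxy; apply: seg0; exists z; split=> //.
  by apply/eqP; rewrite eq_le le metric_triangle.
have D0 : 0 < mdist x y by rewrite mdist_gt0.
set D := mdist x y in D0 segE *.
have M2c : compact [set: M * M] by rewrite -setXTT; exact: compact_setX.
have dc := mdist_continuous.
have ac : continuous (fun p : M * M => mdist x p.1).
  by move=> p; apply: continuous_comp; [exact: cvg_fst|exact: mdistr_continuous].
have bc : continuous (fun p : M * M => mdist p.2 y).
  rewrite (_ : (fun p : M * M => _) = (fun p => mdist y p.2)).
    by move=> p; apply: continuous_comp; [exact: cvg_snd|exact: mdistr_continuous].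
  by apply/funext => p; rewrite metric_sym.
pose G (p : M * M) := mdist x p.1 + mdist p.1 p.2 + mdist p.2 y.
have Gc : continuous G.
  by move=> p; apply: cvgD; [apply: cvgD; [exact: ac|exact: dc]|exact: bc].
(* If the path [x, u, v, y] had length [D], both [u] and [v] would be [x] or [y], and [mdist u v]
   would be 0 or [D]. Compactness makes the excess uniform. *)
have [delta delta0 Gdelta] : exists2 delta : R, 0 < delta &
    forall u v, D / 4 <= mdist u v -> mdist u v <= D / 2 -> D + delta <= G (u, v).
  pose A := [set p : M * M | D / 4 <= mdist p.1 p.2 /\ mdist p.1 p.2 <= D / 2].
  have Ac : compact A.
    apply: subclosed_compact M2c _ => //; apply: closedI.
      by apply: (closed_comp _ (@closed_ge _ (D / 4))) => p _; exact: dc.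
    by apply: (closed_comp _ (@closed_le _ (D / 2))) => p _; exact: dc.
  have [A0|/set0P A0] := eqVneq A set0.
    exists 1 => // u v uv1 uv2; suff : A (u, v) by rewrite A0.
    by [].
  have [[u v]] := compact_EVT_min A0 Ac (continuous_subspaceT Gc).
  rewrite inE => -[/= uv1 uv2] Gmin.
  exists (G (u, v) - D).
    rewrite subr_gt0 ltNge /G/=; apply/negP => le.
    have := metric_triangle x u v; have := metric_triangle u v y.
    move=> t1 t2.
    have {}t1 : mdist x u + mdist u y <= D by lra.
    have {}t2 : mdist x v + mdist v y <= D by lra.
    move: uv1 uv2 le; case/segE : t1 => ->; case/segE : t2 => ->;
      rewrite ?mdistxx -?/D ?(metric_sym y x) -?/D; lra.
  move=> u' v' uv1' uv2'; rewrite addrC subrK; apply: Gmin.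
  by rewrite inE.
have [e [e0 e1 eD]] : exists e : R, [/\ 0 < e, e <= 2^-1 & 2 * e * D < delta].
  pose k := delta / (4 * D).
  have k0 : 0 < k by rewrite divr_gt0// mulr_gt0.
  have kD : k * D = delta / 4 by rewrite /k; field; rewrite gt_eqF.
  exists (Num.min 2^-1 k); case: (leP 2^-1 k) => [le|lt].
    have le2 : 2^-1 * D <= delta / 4 by rewrite -kD ler_pM2r.
    by split; lra.
  by split; [exact: k0|exact: ltW|lra].
apply: contrapT => nex.
have nisol u v : u != v -> exists z,
    mdist u z + mdist z v < mdist u v + e * Num.min (mdist u z) (mdist z v).
  move=> uv; apply: contrapT => /forallNP nz; apply: nex.
  exists u, v, e; split=> //; first by lra.
  by move=> z; rewrite leNgt; exact/negP.
(* [nisol] replaces the end of [(u, v)] nearer to [z] by [z], at distance [a] from it, and shortens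
   the pair by more than [(1 - e) * a]. This keeps the first condition of [K]. *)
pose K := [set p : M * M |
  (1 - e) * (mdist x p.1 + mdist p.2 y) + mdist p.1 p.2 <= D /\
  D / 4 <= mdist p.1 p.2].
have Kc : compact K.
  apply: subclosed_compact M2c _ => //; apply: closedI.
    apply: (closed_comp _ (@closed_le _ D)) => p _.
    apply: cvgD; last exact: dc.
    by apply: cvgMr; apply: cvgD; [exact: ac|exact: bc].
  by apply: (closed_comp _ (@closed_ge _ (D / 4))) => p _; exact: dc.
have K0 : K !=set0.
  by exists (x, y); split=> /=; rewrite ?mdistxx -/D; lra.
have [[u v]] := compact_EVT_min K0 Kc (continuous_subspaceT dc).
rewrite inE => -[/= Kuv uvD] uvmin.
have {}uvmin z w : K (z, w) -> mdist u v <= mdist z w.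
  by move=> Kzw; apply: (uvmin (z, w)); rewrite inE.
have [a0 b0] := (mdist_ge0 x u, mdist_ge0 v y).
(* In [K] the detour exceeds [D] by at most [2 * e * D < delta], so [Gdelta] applies. Above [D / 2],
   the shortened pair keeps length at least [D / 4] and stays in [K]. *)
have uvD2 : D / 2 < mdist u v.
  rewrite ltNge; apply/negP => uvD2; have := Gdelta _ _ uvD uvD2.
  rewrite /G/=; nra.
have /nisol[z] : u != v by rewrite -mdist_gt0; lra.
have [c0 d0] := (mdist_ge0 u z, mdist_ge0 z v).
have t1 := metric_triangle u z v.
have [uzv|zuv] := leP (mdist u z) (mdist z v) => uzvlt.
  have : mdist u v <= mdist z v.
    have t2 := metric_triangle x u z.
    by apply: uvmin; split=> /=; nra.
  nra.
have : mdist u v <= mdist u z.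
  have t2 := metric_triangle z v y.
  by apply: uvmin; split=> /=; nra.
nra.
Qed.

End metric_facts.

(** * Isometric segments by Menger's theorem *)

Section menger.
Context {R : realType} (M : metricType R).
Implicit Types x y z : M.

Lemma closed_mdist_le x (k : R) : closed [set z : M | mdist x z <= k].
Proof.
by apply: (closed_comp _ (@closed_le _ k)) => z _; exact: mdistr_continuous.
Qed.

Lemma closed_mdist_ge x (k : R) : closed [set z : M | k <= mdist x z].
Proof.
by apply: (closed_comp _ (@closed_ge _ k)) => z _; exact: mdistr_continuous.
Qed.

(* Zorn gives a maximal set on which [mdist x] is isometric; a gap in its image
   would be filled by a point strictly between the two ends. *)
Lemma metrically_convex_segments : compact [set: M] -> metrically_convex M ->
  segments M.
Proof.
move=> Mc conv x y.
pose lin (S : set M) := forall a b, S a -> S b ->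
  `|mdist x a - mdist x b| = mdist a b.
(* Adjoining [x] and [y] makes [P] hold for the union of an empty chain and puts both points into a
   maximal set. *)
pose P (S : set M) := lin (S `|` [set x; y]).
have lin1 a : `|mdist x a - mdist x x| = mdist x a.
  by rewrite mdistxx subr0 ger0_norm// mdist_ge0.
have [|S [PS Smax]] := @Zorn_bigcup M P.
  move=> F FP Ftot a b.
  have Pxy : lin [set x; y].
    move=> {}a {}b [] -> [] ->; rewrite ?lin1 ?subrr ?mdistxx ?normr0//.
      by rewrite sub0r normrN ger0_norm// mdist_ge0.
    exact: metric_sym.
  move=> [[A FA Aa]|xya] [[B FB Bb]|xyb].
  - by case: (Ftot _ _ FA FB) => [AB|BA];
      [apply: (FP B)|apply: (FP A)] => //; left => //; [exact: AB|exact: BA].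
  - by apply: (FP A) => //; [left|right].
  - by apply: (FP B) => //; [right|left].
  - exact: Pxy.
have SP z : P (z |` S) -> S z.
  move=> Pz; apply: contrapT => nSz; apply: (Smax (z |` S)) => //.
  split; first by move=> a Sa; right.
  by move=> zS; apply: nSz; apply: zS; left.
have Sx : S x.
  apply: SP; move: PS; rewrite /P; congr lin.
  by apply/seteqP; split=> a /=; tauto.
have Sy : S y.
  apply: SP; move: PS; rewrite /P; congr lin.
  by apply/seteqP; split=> a /=; tauto.
have {PS} : lin S by move=> a b Sa Sb; apply: PS; left.
move=> linS.
have {SP} SP z : (forall a, S a -> `|mdist x a - mdist x z| = mdist a z) -> S z.
  move=> Sz; apply: SP.
  have SE : (z |` S) `|` [set x; y] = z |` S.
    by apply/seteqP; split=> a /=; [move=> [|[]->]//; right|tauto].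
  rewrite /P SE => a b [->|Sa] [->|Sb].
  - by rewrite subrr mdistxx normr0.
  - by rewrite distrC Sz// metric_sym.
  - exact: Sz.
  - exact: linS.
have Scl : closed S.
  move=> z clz; apply: SP => a Sa; apply/eqP; rewrite -subr_eq0 -normr_le0.
  apply/ler_addgt0Pr => e e0; rewrite add0r.
  have e2 : 0 < e / 2 by rewrite divr_gt0.
  have [z' [Sz' /= zz']] := clz _ (nbhs_mdist z e2).
  have := mdist_lipschitz a z a z'; rewrite mdistxx add0r.
  have := mdist_lipschitz x z x z'; rewrite mdistxx add0r.
  have := ler_distD (mdist x z') (mdist x a) (mdist x z).
  have := ler_distD (mdist x z) (mdist x a) (mdist x z').
  rewrite (linS _ _ Sa Sz') (distrC (mdist x z') (mdist x z)).
  move=> ? ? xzz'; rewrite !ler_norml => /andP[? ?].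
  by apply/andP; split; lra.
have Sc : compact S by exact: subclosed_compact Mc _.
have cmd := continuous_subspaceT (@mdistr_continuous _ M x).
have Sonto t : 0 <= t <= mdist x y -> exists2 s, S s & mdist x s = t.
  move=> /andP[t0 ty]; apply: contrapT => nex.
  have {nex} Snt s : S s -> mdist x s != t.
    by move=> Ss; apply/eqP => st; apply: nex; exists s.
  pose A := S `&` [set z | mdist x z <= t].
  pose B := S `&` [set z | t <= mdist x z].
  have Ac : compact A by apply: compact_closedI Sc _; exact: closed_mdist_le.
  have Bc : compact B by apply: compact_closedI Sc _; exact: closed_mdist_ge.
  have A0 : A !=set0 by exists x; split=> //=; rewrite mdistxx.
  have B0 : B !=set0 by exists y.
  have [u] := compact_EVT_max A0 Ac (cmd A).
  rewrite inE => -[Su /= ut] umax.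
  have [v] := compact_EVT_min B0 Bc (cmd B).
  rewrite inE => -[Sv /= vt] vmin.
  have {}umax s : S s -> mdist x s <= t -> mdist x s <= mdist x u.
    by move=> Ss st; apply: umax; rewrite inE.
  have {}vmin s : S s -> t <= mdist x s -> mdist x v <= mdist x s.
    by move=> Ss st; apply: vmin; rewrite inE.
  have {}ut : mdist x u < t by rewrite lt_neqAle ut Snt.
  have {}vt : t < mdist x v by rewrite lt_neqAle vt eq_sym Snt.
  have uvE : mdist u v = mdist x v - mdist x u.
    by rewrite -(linS _ _ Su Sv) distrC gtr0_norm// subr_gt0; lra.
  have /conv[z [uzv zuv]] : u != v by rewrite -mdist_gt0 uvE subr_gt0; lra.
  rewrite /metric_segment/= in uzv.
  have uz : 0 < mdist u z.
    by rewrite mdist_gt0; apply/eqP => E; apply: zuv; left.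
  have zv : 0 < mdist z v.
    by rewrite mdist_gt0; apply/eqP => E; apply: zuv; right.
  have xz : mdist x z = mdist x u + mdist u z.
    by have := metric_triangle x u z; have := metric_triangle x z v; lra.
  (* By [umax] and [vmin] each [a] in [S] lies below [u] or above [v]; the triangle inequality
     through that end determines [mdist a z]. *)
  have Sz : S z.
    apply: SP => a Sa; have ta := metric_triangle x a z.
    have [at_|ta_] := leP (mdist x a) t.
      have au := umax _ Sa at_; have taz := metric_triangle a u z.
      have auE : mdist a u = mdist x u - mdist x a.
        by rewrite -(linS _ _ Sa Su) distrC ger0_norm// subr_ge0.
      by rewrite distrC ger0_norm; lra.
    have av := vmin _ Sa (ltW ta_); have taz := metric_triangle a v z.
    have avE : mdist a v = mdist x a - mdist x v.
      by rewrite -(linS _ _ Sa Sv) ger0_norm// subr_ge0.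
    have txa := metric_triangle x z a; have := metric_sym z a.
    have := metric_sym v z => vz za; rewrite ger0_norm; lra.
  have [zt|zt] := leP (mdist x z) t; first by have := umax _ Sz zt; lra.
  by have := vmin _ Sz (ltW zt); lra.
have /choice[g gP] t : exists s, 0 <= t <= 1 -> S s /\ mdist x s = t * mdist x y.
  have [t01|] := boolP (0 <= t <= 1); last by exists x.
  have [/andP[t0 t1]] := (t01, mdist_ge0 x y) => xy0.
  have [|s] := Sonto (t * mdist x y).
    by rewrite mulr_ge0//= ler_piMl.
  by exists s.
exists g; split.
- have [|_] := gP 0; first by rewrite lexx ler01.
  by rewrite mul0r => /mdist_positivity.
- have [|Sg1 xg1] := gP 1; first by rewrite lexx ler01.
  by apply: mdist_positivity; rewrite -(linS _ _ Sg1 Sy) xg1 mul1r subrr normr0.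
- move=> s t /gP[Ss xs] /gP[St xt].
  by rewrite -(linS _ _ Ss St) xs xt -mulrBl normrM (ger0_norm (mdist_ge0 x y)).
Qed.

End menger.

(** * Curves of minimal length *)

Section geodesics.
Context {R : realType} (M : metricType R).

(** Along an isometric segment every variation telescopes to [mdist x y], while the partition
    [[:: 1]] shows that no curve is shorter. *)
Lemma segments_geodesic : segments M -> geodesic M.
Proof.
move=> seg x y lengths.
have lb : lbound lengths (mdist x y)%:E.
  move=> _ [g [_ g0 g1 _] <-]; apply: ereal_sup_ubound.
  exists [:: 1]; first by apply: itv_partition1; exact: ltr01.
  by rewrite /curve_variation big_nat1/= g0 g1.
suff xyl : lengths (mdist x y)%:E.
  have -> : ereal_inf lengths = (mdist x y)%:E.
    by apply/eqP; rewrite eq_le ereal_inf_lbound// le_ereal_inf_tmp.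
  by [].
have [g [g0 g1 gseg]] := seg x y.
have gvar s : itv_partition 0 1 s -> curve_variation g s = mdist x y.
  move=> ps; rewrite /curve_variation.
  transitivity (\sum_(0 <= n < size s)
      (nth 1 (0 :: s) n.+1 * mdist x y - nth 1 (0 :: s) n * mdist x y)).
    apply: eq_big_nat => n /andP[_ ns].
    have s01 m : (m < (size s).+1)%N -> 0 <= nth 1 (0 :: s) m <= 1.
      by move=> ms; rewrite (itv_partition_nth_ge _ ps)// (itv_partition_nth_le _ ps).
    rewrite /comp gseg ?s01//; last exact: ltnW.
    have := nondecreasing_fun_itv_partition (f := id) _ ps.
    move=> /(_ _ n ns) => nd.
    rewrite -mulrBl distrC ger0_norm// subr_ge0.
    by apply: nd => ? ?.
  rewrite (telescope_sumr (fun n => nth 1 (0 :: s) n * mdist x y))//.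
  by rewrite (itv_partition_nth_size _ ps)/= mul0r subr0 mul1r.
have glen : curve_length g = (mdist x y)%:E.
  rewrite /curve_length; apply/eqP; rewrite eq_le; apply/andP; split.
    by apply: ge_ereal_sup => _ [s /gvar vs <-]; rewrite vs.
  apply: ereal_sup_ubound; exists [:: 1]; last by rewrite gvar//; exact: itv_partition1.
  by apply: itv_partition1; exact: ltr01.
exists g => //; split=> //; last by rewrite glen ltry.
apply/subspace_continuousP => t; rewrite /= in_itv/= => t01.
apply/metricType_numDomainType.cvgrPdist_lt => e e0.
have k0 : 0 < mdist x y + 1 by rewrite ltr_wpDl// mdist_ge0.
have : \forall s \near t, `|t - s| < e / (mdist x y + 1).
  by apply: (@nbhsx_ballx R R t); rewrite divr_gt0.
apply: filterS => s ts; rewrite /= in_itv/= => s01; rewrite gseg//.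
apply: le_lt_trans (_ : `|t - s| * (mdist x y + 1) < e).
  by rewrite ler_wpM2l// lerDl.
by rewrite -ltr_pdivlMr.
Qed.

(** The intermediate value theorem gives a point of a shortest curve at distance [mdist x y / 2]
    from [x]; by the partition [[:: t; 1]], passing through it costs nothing. *)
Lemma geodesic_metrically_convex : geodesic M -> metrically_convex M.
Proof.
move=> geo x y xy.
have D0 : 0 < mdist x y by rewrite mdist_gt0.
have D2 : 0 < mdist x y / 2 < mdist x y by apply/andP; split; lra.
have [len [g [gc g0 g1 _] glen]] := geo x y.
rewrite -len in glen => {len}.
have [|||t] := @IVT R (fun t => mdist x (g t)) 0 1 (mdist x y / 2).
- exact: ler01.
- move=> t; apply: continuous_comp; first exact: gc.
  exact: (@mdistr_continuous R M x (g t)).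
- case/andP : D2 => D1 D2; rewrite g0 g1 mdistxx min_l ?max_r ?(ltW D0)//.
  by apply/andP; split; exact: ltW.
rewrite in_itv/= => /andP[t0 t1] gt.
have {}t0 : 0 < t.
  rewrite lt_neqAle t0 andbT; apply/eqP => t0'; move: gt D2.
  by rewrite -t0' g0 mdistxx => <-; rewrite ltxx.
have {}t1 : t < 1.
  rewrite lt_neqAle t1 andbT; apply/eqP => t1'; move: gt D2.
  by rewrite t1' g1 => <-; rewrite ltxx andbF.
have : ((curve_variation g [:: t; 1])%:E <= curve_length g)%E.
  apply: ereal_sup_ubound; exists [:: t; 1] => //.
  by rewrite /itv_partition/= t0 t1 eqxx.
rewrite glen lee_fin /curve_variation big_nat_recl// big_nat1/= g0 g1 => le.
exists (g t); split.
  by apply/eqP; rewrite eq_le le metric_triangle.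
by move=> [] E; move: gt D2; rewrite E ?mdistxx => <-; rewrite ltxx ?andbF.
Qed.

End geodesics.
(** * Points where the norm is locally affine *)

Section lipschitz_functions.
Context {R : realType} {M : metricType R} (o : M).
Implicit Types (x y u v : M) (f g h : Lip0 o).

Lemma lip0_ex (F : M -> R) (k : R) :
  (forall x y, `|F x - F y| <= k * mdist x y) ->
  exists f, forall x, f x = F x - F o.
Proof.
move=> Fk; have F0 : (fun x => F x - F o : R^o) \in lip0 o.
  rewrite inE; split; first by rewrite subrr.
  by exists k => x y; rewrite [X in `|X|](_ : _ = F x - F y)// opprB addrA subrK.
by exists (MkLip0 F0).
Qed.

Lemma lip0D f g x : (f + g) x = f x + g x. Proof. by []. Qed.
Lemma lip0B f g x : (f - g) x = f x - g x. Proof. by []. Qed.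
Lemma lip0Z (a : R) f x : (a *: f) x = a * f x. Proof. by []. Qed.

Lemma lip0_sum (I : Type) (r : seq I) (P : pred I) (F : I -> Lip0 o) x :
  (\sum_(i <- r | P i) F i) x = \sum_(i <- r | P i) F i x.
Proof. by rewrite -[LHS]/(delta o x _) linear_sum. Qed.

Lemma norm_lip0 f x y : `|f x - f y| <= `|f| * mdist x y.
Proof. exact: ler_lip_norm. Qed.

Lemma norm_lip0_le f (k : R) : 0 <= k ->
  (forall x y, `|f x - f y| <= k * mdist x y) -> `|f| <= k.
Proof. exact: lip_norm_le. Qed.

Definition molecule x y : dual (Lip0 o) :=
  (mdist x y)^-1 *: (delta o x - delta o y).

Lemma moleculeE x y f : molecule x y f = (mdist x y)^-1 * (f x - f y) :> R.
Proof. by []. Qed.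

Lemma moleculeK x y f : x != y -> molecule x y f * mdist x y = f x - f y.
Proof.
by move=> xy; rewrite moleculeE mulrC mulVKf// gt_eqF// mdist_gt0.
Qed.

Lemma molecule_le_norm x y f : `|molecule x y f| <= `|f|.
Proof.
have [->|xy] := eqVneq x y.
  by rewrite moleculeE subrr mulr0 normr0.
have D0 : 0 < mdist x y by rewrite mdist_gt0.
rewrite moleculeE normrM gtr0_norm ?invr_gt0// mulrC ler_pdivrMr//.
exact: norm_lip0.
Qed.

Lemma norm_molecule_le1 x y : `|molecule x y| <= 1.
Proof.
apply: blin_norm_le => f; apply: le_trans; exact: molecule_le_norm.
Qed.

(** * A function peaking at an isolated pair *)

Section peak.
Variables (x y : M) (e D c : R).
Hypotheses (xy : x != y) (e0 : 0 < e) (e1 : e <= 1) (iso : isolated_pair x y e).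
Hypotheses (DE : D = mdist x y) (cE : c = 1 - e / 4).
(** Height [D / 2] makes the difference of the two bumps drop by [D] from [x] to [y]. As [c < 1],
    the radius exceeds [D / 2], so disjointness has to come from isolation. *)
Let peak (z t : M) : R := Num.max (D / 2 - c * mdist z t) 0.

Let c0 : 0 < c. Proof. by have := (e1, cE); case; lra. Qed.

Let peak_lip z s t : `|peak z s - peak z t| <= c * mdist s t.
Proof.
rewrite /peak; have := mdist_lipschitz z s z t; rewrite mdistxx add0r => le.
have : `|c * mdist z s - c * mdist z t| <= c * mdist s t.
  by rewrite -mulrBr normrM gtr0_norm// ler_pM2l.
rewrite !ler_norml => /andP[l1 l2].
have h3 := mulr_ge0 (ltW c0) (mdist_ge0 s t).
by case: (leP (_ - _ * mdist z s)) => h1; case: (leP (_ - _ * mdist z t)) => h2;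
  apply/andP; split; lra.
Qed.

Let peak_disj t : peak x t = 0 \/ peak y t = 0.
Proof.
rewrite /peak; case: (leP (_ - _ * mdist x t)) => h1; [by left|].
case: (leP (_ - _ * mdist y t)) => h2; [by right|].
have := iso t; rewrite (metric_sym t y) -DE => h3.
have t1 := mdist_ge0 x t; have t2 := mdist_ge0 y t.
have D0 : 0 < D by rewrite DE mdist_gt0.
(* With [a] the smaller distance, isolation times [c] gives [c * D <= (1 - e) * (c * a) + c * b < D
   - e * D / 2], whereas [c * D = D - e * D / 4]. *)
have key a b : 0 <= a -> 0 <= b -> 0 < D / 2 - c * a -> 0 < D / 2 - c * b ->
    D + e * a <= a + b -> False.
  move=> a0 b0 ha hb hab.
  have : c * (D + e * a) <= c * (a + b) by rewrite ler_pM2l.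
  have : (1 - e) * (c * a) <= (1 - e) * (D / 2).
    by rewrite ler_wpM2l ?subr_ge0// ltW// -subr_gt0.
  have : 0 < e * D by rewrite mulr_gt0.
  have cD : c * D = D - e * D / 4 by rewrite cE; lra.
  by lra.
exfalso; move: h3; case: (leP (mdist x t)) => h4 h3.
  exact: (key (mdist x t) (mdist y t)).
by apply: (key (mdist y t) (mdist x t)) => //; lra.
Qed.

(* The slope [c] is close enough to 1 that isolation of [(x, y)] forces the two
   bumps to have disjoint supports. *)
Lemma peak_function_aux : exists f, f x - f y = mdist x y /\ forall s t,
  [\/ `|f s - f t| <= c * mdist s t,
     0 <= f s - f t <= mdist s t - e / 4 * (mdist x s + mdist y t)
   | 0 <= f t - f s <= mdist s t - e / 4 * (mdist x t + mdist y s)].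
Proof.
have D0 : 0 < D by rewrite DE mdist_gt0.
have [|f fE] := @lip0_ex (fun t => peak x t - peak y t) (c + c).
  move=> s t; rewrite [X in `|X|](_ : _ =
    (peak x s - peak x t) - (peak y s - peak y t)); last by lra.
  by rewrite (le_trans (ler_normB _ _))// mulrDl lerD.
have {}fE s t : f s - f t = (peak x s - peak y s) - (peak x t - peak y t).
  by rewrite !fE; lra.
(* Only a pair with one point in each bump can have slope above [c]. The average of the isolation
   inequalities at [s] and [t] yields the loss. *)
have key s t : 0 < peak x s -> 0 < peak y t ->
    0 <= f s - f t <= mdist s t - e / 4 * (mdist x s + mdist y t).
  move=> ps qt; rewrite fE.
  have qs : peak y s = 0 by have [E|//] := peak_disj s; rewrite E ltxx in ps.
  have pt : peak x t = 0 by have [//|E] := peak_disj t; rewrite E ltxx in qt.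
  rewrite qs pt subr0 sub0r opprK.
  move: ps qt qs pt; rewrite /peak.
  case: (leP (_ - _ * mdist x s)) => h1; first by rewrite ltxx.
  case: (leP (_ - _ * mdist y t)) => h2; first by rewrite ltxx.
  move=> _ _; case: (leP (_ - _ * mdist y s)) => h3; last by lra.
  move=> _; case: (leP (_ - _ * mdist x t)) => h4; last by lra.
  move=> _.
  have l1 : mdist x s <= mdist s y by rewrite -(ler_pM2l c0) (metric_sym s y); lra.
  have l2 : mdist t y <= mdist x t by rewrite -(ler_pM2l c0) (metric_sym t y); lra.
  have := iso s; have := iso t; rewrite -DE (min_l l1) (min_r l2) => i1 i2.
  have := metric_triangle s t y; have := metric_triangle x s t.
  have l3 : 0 <= e * (mdist x s + mdist y t).
    by rewrite mulr_ge0 ?(ltW e0) ?addr_ge0 ?mdist_ge0.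
  rewrite (metric_sym t y) in i1 l2 *.
  move: cE e0 e1 => cE' ? ?; rewrite cE' in h1 h2 *; move=> ? ?.
  by  apply/andP; split; lra.
exists f; split.
  rewrite -DE.
  have px : peak x x = D / 2 by rewrite /peak mdistxx mulr0 subr0 max_l// divr_ge0// ltW.
  have py : peak y y = D / 2 by rewrite /peak mdistxx mulr0 subr0 max_l// divr_ge0// ltW.
  rewrite fE px py; have [E|->] := peak_disj x; first by rewrite E in px; lra.
  by have [->|E] := peak_disj y; [lra|rewrite E in py; lra].
move=> s t.
have pge0 z w : 0 <= peak z w by rewrite /peak le_max lexx orbT.
have [/andP[ps qt]|n1] := boolP ((0 < peak x s) && (0 < peak y t)).
  by apply: Or32; exact: key.
have [/andP[pt qs]|n2] := boolP ((0 < peak x t) && (0 < peak y s)).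
  by apply: Or33; rewrite (metric_sym s t); exact: key.
apply: Or31; rewrite fE.
have h1 := peak_lip x s t; have h2 := peak_lip y s t.
have p0 z w : ~~ (0 < peak z w) -> peak z w = 0.
  by rewrite -leNgt => le; apply/eqP; rewrite eq_le le pge0.
have [ps|/p0 ps] := boolP (0 < peak x s).
  have qs : peak y s = 0 by have [E|//] := peak_disj s; rewrite E ltxx in ps.
  have qt : peak y t = 0 by apply: p0; move: n1; rewrite ps.
  by rewrite qs qt !subr0.
have [qs|/p0 qs] := boolP (0 < peak y s).
  have pt : peak x t = 0 by apply: p0; move: n2; rewrite qs andbT.
  by rewrite ps pt !sub0r opprK addrC distrC.
rewrite ps qs subr0; have [E|E] := peak_disj t; rewrite E.
  by move: h2; rewrite qs !sub0r opprK normrN.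
by move: h1; rewrite ps subr0 !sub0r.
Qed.

End peak.

Lemma peak_function x y (e : R) : x != y -> 0 < e -> e <= 1 ->
  isolated_pair x y e -> exists f, f x - f y = mdist x y /\ forall s t,
  [\/ `|f s - f t| <= (1 - e / 4) * mdist s t,
     0 <= f s - f t <= mdist s t - e / 4 * (mdist x s + mdist y t)
   | 0 <= f t - f s <= mdist s t - e / 4 * (mdist x t + mdist y s)].
Proof. by move=> xy e0 e1 iso; exact: (@peak_function_aux x y e _ _ xy e0 e1 iso). Qed.

End lipschitz_functions.
Section normed_space_facts.
Context {R : realType} (X : normedModType R).
Implicit Types (f g h : X) (L N : dual X).

Lemma dualE_norm L h : `|L h| <= `|L| * `|h|.
Proof. exact: ler_blin_norm. Qed.

Lemma dual_ball_le L h : `|L| <= 1 -> L h <= `|h|.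
Proof.
move=> L1; apply: le_trans (ler_norm _) _; apply: le_trans (dualE_norm _ _) _.
by rewrite ler_piMl.
Qed.

Lemma dualB L N h : (L - N) h = L h - N h. Proof. by []. Qed.
Lemma dualZ (a : R) L h : (a *: L) h = a * L h. Proof. by []. Qed.

Lemma dual_addE L f h : L (f + h) = L f + L h. Proof. exact: linearD. Qed.
Lemma dual_subE L f h : L (f - h) = L f - L h. Proof. exact: linearB. Qed.
Lemma dual_scaleE L (a : R) h : L (a *: h) = a * L h. Proof. exact: linearZ. Qed.
Lemma dual_oppE L h : L (- h) = - L h. Proof. exact: linearN. Qed.
Lemma dual_zeroE L : L 0 = 0. Proof. exact: linear0. Qed.

Lemma dual_sumE L (I : Type) (r : seq I) (P : pred I) (F : I -> X) :
  L (\sum_(i <- r | P i) F i) = \sum_(i <- r | P i) L (F i).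
Proof. exact: linear_sum. Qed.

Lemma dual_norm_le L (k : R) : 0 <= k -> (forall h, L h <= k * `|h|) ->
  `|L| <= k.
Proof.
move=> k0 Lk; apply: blin_norm_le => h h1; rewrite ler_norml.
have := Lk h; have := Lk (- h); rewrite normrN linearN.
have : k * `|h| <= k by rewrite ler_piMr.
by move=> ? ? ?; apply/andP; split; lra.
Qed.

Lemma differentiable_gateaux f :
  differentiable (norm_fun X) f -> gateaux_differentiable (norm_fun X) f.
Proof.
move=> df.
have d_blin : ('d (norm_fun X) f : X -> R^o) \in blin X R^o.
  by rewrite inE; split; [exact: linearP|exact: diff_continuous].
exists (Blin d_blin) => v; apply: DeriveDef; first exact: diff_derivable.
exact: deriveE.
Qed.

(** * Consequences of a norm being affine near a point *)

Section locally_affine_norm.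
Variables (f : X) (L : dual X) (eta : R).
Hypotheses (f1 : `|f| = 1) (eta0 : 0 < eta) (eta1 : eta <= 1).
Hypothesis affine : forall h, `|h| <= eta -> `|f + h| = 1 + L h.

Lemma affine_norm_peak : L f = 1.
Proof.
have := @affine (eta *: f); rewrite normrZ f1 mulr1 gtr0_norm// => /(_ (lexx _)).
rewrite -[X in `|X + _|]scale1r -scalerDl normrZ f1 mulr1 gtr0_norm ?addr_gt0//.
move=> /addrI; rewrite linearZ/= => /esym/eqP.
by rewrite -subr_eq0 -[X in _ - X]mulr1 -mulrBr mulf_eq0 gt_eqF//= subr_eq0 => /eqP.
Qed.

(** For [k] of norm [eta], [N (f + k) <= 1 + L k], that is, [(N - L) k <= 1 - N f]. Thus [f] exposes
    [L] at a linear rate. *)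
Lemma affine_norm_exposed N : `|N| <= 1 -> eta * `|N - L| <= 1 - N f.
Proof.
move=> N1; have Nf : N f <= 1 by rewrite (le_trans (dual_ball_le _ N1)) ?f1.
rewrite -ler_pdivlMl//; apply: dual_norm_le => [|h].
  by rewrite mulr_ge0 ?subr_ge0// invr_ge0 ltW.
have [->|h0] := eqVneq h 0; first by rewrite linear0 normr0 mulr0.
have nh : 0 < `|h| by rewrite normr_gt0.
pose k := (eta / `|h|) *: h.
have nk : `|k| = eta.
  by rewrite normrZ gtr0_norm ?divr_gt0// divfK// gt_eqF.
have := dual_ball_le (f + k) N1; rewrite affine ?nk// linearD => le.
rewrite [X in X <= _](_ : _ = N h - L h)//.
have kE (K : dual X) : K h = eta^-1 * (K k * `|h|).
  rewrite linearZ/= /GRing.scale/=; field.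
  by rewrite !gt_eqF.
rewrite !kE -mulrBr -mulrBl -[X in _ <= X]mulrA.
rewrite ler_pM2l ?invr_gt0// ler_pM2r//; lra.
Qed.

(** As [L f = 1] is the largest possible value, both ends of a convex combination take it at [f];
    [affine_norm_exposed] then identifies them with [L]. *)
Lemma affine_norm_extreme : `|L| <= 1 -> extreme_point (unit_ball (dual X)) L.
Proof.
move=> L1; split=> // Y Z t Y1 Z1 /andP[t0 t1] LE.
have Y1f := dual_ball_le f Y1; have Z1f := dual_ball_le f Z1.
rewrite f1 in Y1f Z1f.
have E : t * Y f + (1 - t) * Z f = 1 by have := affine_norm_peak; rewrite {1}LE.
have key N : `|N| <= 1 -> N f = 1 -> N = L.
  move=> N1 Nf; have := affine_norm_exposed N1.
  rewrite Nf subrr pmulr_rle0// normr_le0 subr_eq0 => /eqP //.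
have : 0 <= t * (1 - Y f) by rewrite mulr_ge0 ?subr_ge0// ltW.
have : 0 <= (1 - t) * (1 - Z f) by rewrite mulr_ge0 ?subr_ge0// ltW.
move=> h1 h2; split; apply: key => //; apply/eqP; rewrite eq_le ?Y1f ?Z1f/=.
  by rewrite -subr_le0 -(pmulr_rle0 _ t0); lra.
by rewrite -subr_le0 -(@pmulr_rle0 _ (1 - t)) ?subr_gt0//; lra.
Qed.

Lemma affine_norm_differentiable : differentiable (norm_fun X) f.
Proof.
have Lloc : norm_fun X \o shift f = cst (norm_fun X f) + L +o_ (0 : X) id.
  apply/eqaddoP => eps eps0; near=> h.
  have hE : `|h| <= eta.
    by near: h; apply: (@nbhs0_le _ X).
  rewrite [X in `|X|](_ : _ = `|f + h| - (`|f| + L h)); last first.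
    by rewrite (addrC f).
  by rewrite affine// f1 subrr normr0 mulr_ge0// ltW.
have Lc : continuous L := @blin_continuous _ _ _ L.
have dE := diff_unique Lc Lloc.
apply/diff_locallyP; rewrite dE; split=> //.
Unshelve. all: by end_near. Qed.

(** The operator [g |-> - L g *: f] sends [f] to [- f], so its norm is at least 1; adding the
    identity gives norm at most [2 - eta / 2]. *)
Lemma affine_norm_not_daugavet : `|L| <= 1 -> ~ daugavet_property X.
Proof.
move=> L1 dau.
have T_blin : (fun g => - L g *: f) \in blin X X.
  rewrite inE; split=> [a g h|g].
    by rewrite linearP/= opprD scalerDl scalerA mulrN.
  apply: cvgZr_tmp; apply: cvgN; exact: blin_continuous.
pose T := Blin T_blin.
have f0 : f != 0 by rewrite -normr_eq0 f1 oner_eq0.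
have /dau : rank_one T.
  exists f => //; apply/seteqP; split=> _ [c _ <-]; first by exists (- L c).
  by exists (- c *: f) => //=; rewrite linearZ/= affine_norm_peak /GRing.scale/= mulr1 opprK.
apply/eqP; rewrite lt_eqF//; apply: lt_le_trans (_ : 2 <= _); last first.
  have : `|T f| <= `|T| * `|f| by exact: ler_blin_norm.
  by rewrite f1 mulr1 /T/= affine_norm_peak normrZ f1 normrN normr1; lra.
apply: le_lt_trans (_ : 2 - eta / 2 < 2); last first.
  by have := eta0; lra.
apply: blin_norm_le => g g1.
have -> : (T + blin_id X) g = g - L g *: f by rewrite -[LHS]/(- L g *: f + g) scaleNr addrC.
(* Since [f - eta *: h] has norm [1 - eta * s], the identity [s *: f - h = s *: (f - eta *: h) - (1
   - eta * s) *: h] bounds the norm by [2 - 2 * eta * s]. *)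
have key s h : `|h| <= 1 -> s = L h -> 2^-1 <= s -> `|h - s *: f| <= 2 - eta / 2.
  move=> h1 sE s2.
  have s1 : s <= 1 by rewrite sE (le_trans (dual_ball_le _ L1)).
  have eta0' := eta0; have eta1' := eta1.
  have es1 : eta * s <= 1 by have : eta * s <= eta * 1 by [rewrite ler_pM2l]; lra.
  have hE : `|f - eta *: h| = 1 - eta * s.
    rewrite -scaleNr affine; first by rewrite linearZ/= -sE scaleNr.
    by rewrite normrZ normrN gtr0_norm// ler_piMr// ltW.
  rewrite distrC (_ : _ - _ = s *: (f - eta *: h) - (1 - eta * s) *: h).
    apply: le_trans (ler_normB _ _) _; rewrite !normrZ hE.
    rewrite [`|s|]ger0_norm ?ger0_norm ?subr_ge0//; last by lra.
    have : (1 - eta * s) * `|h| <= 1 - eta * s by rewrite ler_piMr// subr_ge0.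
    have : eta * (2^-1) <= eta * s by rewrite ler_pM2l.
    have : s * (1 - eta * s) <= 1 * (1 - eta * s) by rewrite ler_wpM2r// subr_ge0.
    lra.
  rewrite scalerBr scalerBl scale1r scalerA (mulrC s) opprB addrA.
  by rewrite subrK.
have [s1|s1] := leP 2^-1 (L g); first exact: key.
have [s2|s2] := leP (L g) (- 2^-1).
  have := key (- L g) (- g); rewrite normrN linearN lerNr => /(_ g1 erefl s2).
  by rewrite scaleNr opprK -normrN opprD opprK.
(* For small [L g] the crude bound [3 / 2] is at most [2 - eta / 2], because [eta <= 1]. *)
apply: le_trans (ler_normB _ _) _; rewrite normrZ f1 mulr1.
have : `|L g| <= 2^-1 by rewrite ler_norml !ltW.
by have := eta1; lra.
Qed.

End locally_affine_norm.
End normed_space_facts.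

(** * Exposed molecules in the free space *)

Section free_space_facts.
Context {R : realType} {M : metricType R} (o : M).
Implicit Types (x y u v : M) (f g h : Lip0 o) (m n : FreeSpace o).

Lemma evaluation_subproof f : (fun m => free_val m f) \in blin (FreeSpace o) R^o.
Proof.
rewrite inE.
have lin : linear ((fun m => free_val m f) : FreeSpace o -> R^o) by [].
pose L := GRing.isLinear.Build R (FreeSpace o) R^o *:%R _ lin.
pose h : {linear FreeSpace o -> R^o} := HB.pack (fun m => free_val m f : R^o) L.
split=> //; apply: (@bounded_linear_continuous R (FreeSpace o) R^o h).
apply/linear_boundedP; near=> r => m /=.
apply: le_trans (dualE_norm _ _) _.
by rewrite mulrC ler_wpM2r.
Unshelve. all: by end_near. Qed.

Definition evaluation f : dual (FreeSpace o) := Blin (evaluation_subproof f).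

Lemma evaluationE f m : evaluation f m = free_val m f. Proof. by []. Qed.

Lemma norm_evaluation_le f : `|evaluation f| <= `|f|.
Proof.
apply: dual_norm_le => // m; rewrite evaluationE mulrC.
by apply: le_trans (ler_norm _) _; exact: dualE_norm.
Qed.

Lemma free_normE m : `|m| = `|free_val m|. Proof. by []. Qed.

Lemma delta_in_free x : delta o x \in @free_carrier R M o.
Proof.
rewrite inE; apply: subset_closure.
exists 1%N, (fun=> 1), (fun=> delta o x); split=> [_|]; first by exists x.
by rewrite big_ord1 scale1r.
Qed.

Lemma molecule_in_free x y : molecule o x y \in @free_carrier R M o.
Proof. by apply: rpredZ; apply: rpredB; exact: delta_in_free. Qed.

Definition free_molecule x y : FreeSpace o := MkFreeSpace (molecule_in_free x y).

Lemma free_moleculeE x y f : free_val (free_molecule x y) f = molecule o x y f.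
Proof. by []. Qed.

(** The molecule itself gives the lower bound. A steep pair at distances [a], [b] from [x], [y]
    loses [e / 4 * (a + b)], which pays for comparing [h] there with [h] at [(x, y)]: this costs
    twice the norm of [h] times [a + b]. The other pairs have slope at most [1 - e / 8]. *)
Lemma isolated_pair_affine x y (e : R) : x != y -> 0 < e -> e <= 1 ->
  isolated_pair x y e -> exists f, `|f| = 1 /\
    forall h, `|h| <= e / 8 -> `|f + h| = 1 + molecule o x y h.
Proof.
move=> xy e0 e1 iso; have [f [fxy fP]] := peak_function o xy e0 e1 iso.
have D0 : 0 < mdist x y by rewrite mdist_gt0.
have mf : molecule o x y f = 1 by rewrite moleculeE fxy mulVf// gt_eqF.
have aff h : `|h| <= e / 8 -> `|f + h| = 1 + molecule o x y h.
  move=> he; have mh := molecule_le_norm x y h; have h0 := normr_ge0 h.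
  have mhK := moleculeK h xy.
  set k : R := molecule o x y h in mh mhK *.
  have := mh; rewrite ler_norml => /andP[mh1 mh2].
  apply/eqP; rewrite eq_le; apply/andP; split; last first.
    have <- : molecule o x y (f + h) = 1 + k.
      by rewrite dual_addE mf.
    exact: le_trans (ler_norm _) (molecule_le_norm _ _ _).
  have key s t : 0 <= f s - f t <= mdist s t - e / 4 * (mdist x s + mdist y t) ->
      `|f s - f t + (h s - h t)| <= (1 + k) * mdist s t.
    move=> /andP[l1 l2]; set a := mdist x s in l2 *; set b := mdist y t in l2 *.
    have a0 : 0 <= a := mdist_ge0 _ _; have b0 : 0 <= b := mdist_ge0 _ _.
    have d0 := mdist_ge0 s t.
    have := norm_lip0 h s t; rewrite ler_norml => /andP[n1 n2].
    have := norm_lip0 h x s; rewrite ler_norml => /andP[n3 n4].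
    have := norm_lip0 h y t; rewrite ler_norml => /andP[n5 n6].
    rewrite -/a in n3 n4; rewrite -/b in n5 n6.
    have := mdist_lipschitz x y s t; rewrite -/a -/b => dab.
    have kd : `|k * (mdist x y - mdist s t)| <= `|h| * (a + b).
      by rewrite normrM ler_pM.
    move: kd; rewrite ler_norml => /andP[kd1 kd2].
    have hab : `|h| * (a + b) <= e / 8 * (a + b) by rewrite ler_wpM2r// addr_ge0.
    have hd : `|h| * mdist s t <= e / 8 * mdist s t by rewrite ler_wpM2r.
    have kd3 : - `|h| * mdist s t <= k * mdist s t by rewrite ler_wpM2r.
    have ed : e * mdist s t <= 1 * mdist s t by rewrite ler_wpM2r.
    by rewrite ler_norml; apply/andP; split; lra.
  apply: norm_lip0_le => [|s t]; first by lra.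
  rewrite !lip0D opprD addrACA.
  have [ft|ft|ft] := fP s t; last 2 first.
  - exact: key.
  - rewrite -normrN opprD !opprB (metric_sym s t); apply: key.
    by rewrite (metric_sym t s).
  have d0 := mdist_ge0 s t.
  have kd3 : - `|h| * mdist s t <= k * mdist s t by rewrite ler_wpM2r.
  have hd : `|h| * mdist s t <= e / 8 * mdist s t by rewrite ler_wpM2r.
  apply: le_trans (ler_normD _ _) _; have := norm_lip0 h s t; lra.
exists f; split=> //.
have := aff 0; rewrite normr0 addr0 dual_zeroE addr0; apply.
by rewrite divr_ge0// ltW.
Qed.

Section exposed_molecule.
Variables (x y : M) (f : Lip0 o) (eta : R).
Hypotheses (f1 : `|f| = 1) (eta0 : 0 < eta).
Hypothesis affine : forall h, `|h| <= eta -> `|f + h| = 1 + molecule o x y h.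

(** The evaluation at [f] exposes the molecule: [affine_norm_exposed] bounds the distance of [u n]
    to it linearly by the defect of [u n] at [f]. *)
Lemma strongly_exposed_molecule : strongly_exposed_point (free_molecule x y).
Proof.
have m1 := norm_molecule_le1 o x y.
have mf : molecule o x y f = 1 := affine_norm_peak f1 eta0 affine.
have mE : `|free_molecule x y| = 1.
  apply/eqP; rewrite eq_le free_normE m1/=.
  have := dualE_norm (molecule o x y) f.
  by rewrite mf f1 mulr1 normr1.
split=> //; exists (evaluation f).
  apply/eqP; rewrite /= eq_le -{1}f1 norm_evaluation_le/=.
  have := dualE_norm (evaluation f) (free_molecule x y).
  by rewrite evaluationE free_moleculeE mf mE mulr1 normr1.
move=> u u1; rewrite evaluationE free_moleculeE mf => uf.
apply/cvgrPdist_le => eps eps0.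
have ee : 0 < eta * eps by rewrite mulr_gt0.
move/cvgrPdist_le : uf => /(_ _ ee); apply: filterS => n /= le.
have := affine_norm_exposed f1 eta0 affine (u1 n).
rewrite -normrN opprB => le2.
rewrite -(ler_pM2l eta0); apply: le_trans le2 _.
exact: le_trans (ler_norm _) le.
Qed.

End exposed_molecule.
End free_space_facts.
(** * Consequences of metric convexity *)

Section norming_pairs.
Context {R : realType} {M : metricType R} (o : M).
Implicit Types (x y u v p z : M) (f g h : Lip0 o).

Definition slope_above f (eps : R) u v :=
  u != v /\ (`|f| - eps) * mdist u v < f u - f v.

Lemma slope_above_exists f (eps : R) : (exists x, x != o) -> 0 < eps ->
  exists u v, slope_above f eps u v.
Proof.
move=> [x xo] eps0.
have fsup : has_sup (slopes f).
  split; first by exists (`|f x - f o| / mdist x o), (x, o).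
  by exists (lip_norm f) => _ [[u v] /= uv <-]; exact: lip_norm_slope.
have [_ [[u v] /= uv <-]] := sup_adherent eps0 fsup.
rewrite -[sup _]/(`|f|) ltr_pdivlMr ?mdist_gt0// => lt.
have [fuv|fuv] := leP 0 (f u - f v).
  by exists u, v; split=> //; rewrite ger0_norm in lt.
exists v, u; split; first by rewrite eq_sym.
by rewrite metric_sym; rewrite ltr0_norm// opprB in lt.
Qed.

Hypotheses (Mseg : segments M) (Mcompact : compact [set: M]).
Hypothesis Mnontrivial : exists x, x != o.

Lemma mdist_bounded : exists B : R, forall x y, mdist x y <= B.
Proof.
have M2c : compact [set: M * M] by rewrite -setXTT; exact: compact_setX.
have M20 : [set: M * M] !=set0 by exists (o, o).
have [[u v] _ uvmax] := compact_EVT_max M20 M2c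
  (continuous_subspaceT (@mdist_continuous R M)).
by exists (mdist u v) => x y; apply: (uvmax (x, y)); rewrite inE.
Qed.

(* Cutting off the first or the last piece of a segment, whichever is far from
   [p]. *)
Lemma slope_above_cut f (eps : R) u v p : 0 < eps -> eps <= 1 ->
  slope_above f (eps * (eps / 4)) u v ->
  exists u' v', [/\ slope_above f eps u' v', mdist u u' <= mdist u v,
    mdist u' v' <= eps * mdist u v & mdist u' v' <= eps * mdist p u'].
Proof.
move=> eps0 eps1 [uv fuv]; have [g [g0 g1 gseg]] := Mseg u v.
have D0 : 0 < mdist u v by rewrite mdist_gt0.
(* The rest of the segment, of length [(1 - t) * mdist u v], has at most full slope. The whole
   defect [eps * t * mdist u v] thus falls on a piece of length [t * mdist u v], whose slope defect
   is [eps]. *)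
pose t := eps / 4.
have t0 : 0 < t by rewrite divr_gt0.
have t01 : 0 <= t <= 1 by rewrite /t; apply/andP; split; lra.
have s01 : 0 <= 1 - t <= 1 by rewrite /t; apply/andP; split; lra.
have i0 : 0 <= (0 : R) <= 1 by rewrite lexx ler01.
have i1 : 0 <= (1 : R) <= 1 by rewrite lexx ler01.
have gd0t : mdist u (g t) = t * mdist u v.
  by rewrite -{1}g0 gseg// sub0r normrN gtr0_norm.
have gdt1 : mdist (g t) v = (1 - t) * mdist u v.
  by rewrite -{1}g1 gseg// distrC ger0_norm//; case/andP : s01.
have gd0s : mdist u (g (1 - t)) = (1 - t) * mdist u v.
  by rewrite -{1}g0 gseg// sub0r normrN ger0_norm//; case/andP : s01.
have gds1 : mdist (g (1 - t)) v = t * mdist u v.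
  by rewrite -{1}g1 gseg// addrAC subrr sub0r normrN gtr0_norm.
have n1 := norm_lip0 f (g t) v; have n2 := norm_lip0 f u (g (1 - t)).
rewrite gdt1 in n1; rewrite gd0s in n2.
have n3 := le_trans (ler_norm _) n1; have n4 := le_trans (ler_norm _) n2.
have tD : 0 < t * mdist u v by rewrite mulr_gt0.
have ed : eps * mdist u v <= 1 * mdist u v by rewrite ler_pM2r.
have [pu|pu] := leP (mdist u v / 4) (mdist p u).
  exists u, (g t); rewrite /slope_above -mdist_gt0 gd0t mdistxx; split=> //.
  - split=> //; rewrite /t in n3 *; lra.
  - exact: ltW.
  - by rewrite /t -mulrA ler_pM2l//; lra.
  - by rewrite /t -mulrA ler_pM2l//; lra.
exists (g (1 - t)), v; rewrite /slope_above -mdist_gt0 gds1 gd0s; split=> //.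
- split=> //; rewrite /t in n4 *; lra.
- by rewrite ler_piMl ?(ltW D0)//; case/andP : s01.
- by rewrite /t -mulrA ler_pM2l//; lra.
- have := metric_triangle u p (g (1 - t)); rewrite gd0s (metric_sym u p) => tr.
  rewrite /t -mulrA ler_pM2l//; rewrite /t in tr; lra.
Qed.

(** [p] is a cluster point of the first points of ever shorter almost norming pairs. Such a pair
    near [p] is cut once more, to be short compared with its distance from [p]. *)
Lemma slope_above_cluster f : exists p, forall r eps : R, 0 < r -> 0 < eps ->
  exists u v, [/\ slope_above f eps u v, mdist p u < r
    & mdist u v <= eps * mdist p u].
Proof.
have [B dB] := mdist_bounded.
have B0 : 0 <= B by rewrite -(mdistxx o).
pose e n : R := n.+1%:R^-1.
have e0 n : 0 < e n by rewrite invr_gt0.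
have e1 n : e n <= 1 by rewrite invf_le1// ler1n.
have /choice[w wP] n : exists w : M * M,
    slope_above f (e n) w.1 w.2 /\ mdist w.1 w.2 <= e n * B.
  have ee : 0 < e n * (e n / 4) by rewrite mulr_gt0// divr_gt0.
  have [u [v uv]] := slope_above_exists f Mnontrivial ee.
  (* This first cut serves only to shorten the pair; [o] is an arbitrary centre. *)
  have [u' [v' [uv' _ duv _]]] := slope_above_cut o (e0 n) (e1 n) uv.
  exists (u', v'); split=> //=; apply: le_trans duv _.
  by rewrite ler_pM2l.
have [|p [_ clp]] := Mcompact (F := (fun n => (w n).1) @ \oo) _.
  exact: filterT.
exists p => r eps r0 eps0.
wlog eps1 : eps eps0 / eps <= 1 => [wl|].
  have [/wl|/ltW eps1] := leP eps 1; first exact.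
  have [u [v [[uv fuv] pu duv]]] := wl 1 ltr01 (lexx _).
  exists u, v; split=> //.
    split=> //; apply: le_lt_trans fuv; rewrite ler_wpM2r ?mdist_ge0//.
    by rewrite lerD2l lerN2.
  by apply: le_trans duv _; rewrite ler_wpM2r ?mdist_ge0.
have r2 : 0 < r / 2 by rewrite divr_gt0.
have ep : 0 < eps * (eps / 4) by rewrite mulr_gt0// divr_gt0.
have tail : \forall n \near \oo, e n <= eps * (eps / 4) /\ e n * B < r / 2.
  have k0 : 0 < (r / 2) / (B + 1) by rewrite divr_gt0// ltr_wpDl.
  near=> n; split.
    by apply: ltW; near: n; exact: near_infty_natSinv_lt (PosNum ep).
  have : e n < (r / 2) / (B + 1).
    by near: n; exact: near_infty_natSinv_lt (PosNum k0).
  rewrite ltr_pdivlMr ?ltr_wpDl//; have := e0 n; rewrite mulrDr mulr1; lra.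
have [z [[n [en enB] <-] /= pz]] : ((fun n => (w n).1) @`
    [set n | e n <= eps * (eps / 4) /\ e n * B < r / 2]) `&`
    [set z | mdist p z < r / 2] !=set0.
  apply: clp; last exact: nbhs_mdist.
  by apply: filterS tail => n nP; exists n.
have [[uv fuv] duv] := wP n.
have fuv' : slope_above f (eps * (eps / 4)) (w n).1 (w n).2.
  split=> //; apply: le_lt_trans fuv; rewrite ler_wpM2r ?mdist_ge0//.
  by rewrite lerD2l lerN2.
have [u' [v' [uv' du' _ pu']]] := slope_above_cut p eps0 eps1 fuv'.
exists u', v'; split=> //.
by have := metric_triangle p (w n).1 u'; lra.
Unshelve. all: by end_near. Qed.

(** Each [u n] is more than eight times closer to [p] than its predecessor and [rho n] is half its
    distance from [p], so the balls lie in disjoint annuli around [p]. *)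
Lemma slope_above_disjoint f (eps : nat -> R) : (forall n, 0 < eps n) ->
  exists (u v : nat -> M) (rho : nat -> R), [/\
    forall n, slope_above f (eps n) (u n) (v n),
    forall n, mdist (u n) (v n) <= eps n * rho n &
    forall m n z, mdist (u m) z < rho m -> mdist (u n) z < rho n -> m = n].
Proof.
move=> eps0; have [p pP] := slope_above_cluster f.
have /choice[F FP] (q : R * nat) : exists w : M * M, 0 < q.1 ->
    [/\ slope_above f (eps q.2) w.1 w.2, mdist p w.1 < q.1
      & mdist w.1 w.2 <= eps q.2 / 2 * mdist p w.1].
  have [q0|] := boolP (0 < q.1); last by exists (o, o).
  have e2 : 0 < Num.min (eps q.2) (eps q.2 / 2) by rewrite lt_min eps0 divr_gt0.
  have [u [v [[uv fuv] pu duv]]] := pP _ _ q0 e2.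
  exists (u, v) => _; split=> //.
    split=> //; apply: le_lt_trans fuv; rewrite ler_wpM2r ?mdist_ge0//.
    by rewrite lerD2l lerN2 ge_min lexx.
  apply: le_trans duv _; rewrite ler_wpM2r ?mdist_ge0//.
  by rewrite ge_min lexx orbT.
pose fix s n := if n is k.+1 then F (mdist p (s k).1 / 8, k.+1) else F (1, 0%N).
have sP n : [/\ slope_above f (eps n) (s n).1 (s n).2, 0 < mdist p (s n).1
    & mdist (s n).1 (s n).2 <= eps n / 2 * mdist p (s n).1].
  have pos w (a : R) : w.1 != w.2 -> 0 < a -> mdist w.1 w.2 <= a * mdist p w.1 ->
      0 < mdist p w.1.
    by rewrite -mdist_gt0 => w0 a0 /(lt_le_trans w0); rewrite pmulr_rgt0.
  elim: n => [|n [_ IH _]].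
    have [[uv fuv] pu duv] := FP (1, 0%N) ltr01; split=> //.
    by apply: pos duv => //; rewrite divr_gt0.
  have /FP[[uv fuv] pu duv] : 0 < (mdist p (s n).1 / 8, n.+1).1 by rewrite divr_gt0.
  by split=> //; apply: pos duv => //; rewrite divr_gt0.
have s8 n : mdist p (s n.+1).1 < mdist p (s n).1 / 8.
  have [_ IH _] := sP n.
  by have /FP[] : 0 < (mdist p (s n).1 / 8, n.+1).1 by rewrite divr_gt0.
have sdec m n : (m < n)%N -> mdist p (s n).1 < mdist p (s m).1 / 8.
  elim: n => // n IH; rewrite ltnS leq_eqVlt => /predU1P[->|/IH lt]; first exact: s8.
  apply: lt_trans (s8 n) _; apply: le_lt_trans lt.
  by have [_ ? _] := sP n; lra.
exists (fun n => (s n).1), (fun n => (s n).2), (fun n => mdist p (s n).1 / 2).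
split=> [n|n|]; first by have [] := sP n.
  by have [_ _ le] := sP n; rewrite mulrA mulrAC.
suff key m n z : (m < n)%N -> mdist (s m).1 z < mdist p (s m).1 / 2 ->
    mdist (s n).1 z < mdist p (s n).1 / 2 -> False.
  by move=> m n z zm zn; case: (ltngtP m n) => // lt; exfalso;
    [exact: key lt zm zn|exact: key lt zn zm].
move=> /sdec lt zm zn.
have := metric_triangle p z (s m).1; have := metric_triangle p (s n).1 z.
by rewrite (metric_sym z); have [_ ? _] := sP m; lra.
Qed.

End norming_pairs.

(** * Suprema and extensions of Lipschitz functions *)

Section lipschitz_extension.
Context {R : realType} {M : metricType R}.
Implicit Types (x y z a : M) (k : R).

Lemma sup_lipschitz (I : Type) (A : set I) (G : I -> M -> R) k : A !=set0 ->
  (forall i, A i -> forall x y, `|G i x - G i y| <= k * mdist x y) ->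
  (forall x, has_ubound [set G i x | i in A]) ->
  forall x y, `|sup [set G i x | i in A] - sup [set G i y | i in A]|
    <= k * mdist x y.
Proof.
move=> [i0 Ai0] Gk Gub x y.
have key u v : sup [set G i u | i in A] <= sup [set G i v | i in A] + k * mdist u v.
  apply: ge_sup; first by exists (G i0 u), i0.
  move=> _ [i Ai <-]; have := le_trans (ler_norm _) (Gk i Ai u v).
  have : G i v <= sup [set G i v | i in A] by apply: (ub_le_sup (Gub v)); exists i.
  by lra.
have := key x y; have := key y x; rewrite (metric_sym y x) ler_norml.
by move=> ? ?; apply/andP; split; lra.
Qed.

(** McShane's formula, in the form that gives the smallest extension. *)
Lemma lipschitz_extension (A : set M) (phi : M -> R) k : A !=set0 -> 0 <= k ->
  (forall a b, A a -> A b -> `|phi a - phi b| <= k * mdist a b) ->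
  exists F : M -> R, (forall x y, `|F x - F y| <= k * mdist x y) /\
    forall a, A a -> F a = phi a.
Proof.
move=> A0 k0 phik; pose G a z := phi a - k * mdist a z.
have Gk a x y : `|G a x - G a y| <= k * mdist x y.
  rewrite /G opprB addrC addrA subrK -mulrBr normrM ger0_norm// ler_wpM2l//.
  by rewrite (le_trans (mdist_lipschitz _ _ _ _))// mdistxx add0r metric_sym.
have phiG a b z : A a -> A b -> G b z <= phi a + k * mdist a z.
  move=> Aa Ab; have := le_trans (ler_norm _) (phik b a Ab Aa).
  have : k * mdist b a <= k * (mdist b z + mdist a z).
    by rewrite ler_wpM2l// (metric_sym a z) metric_triangle.
  by rewrite /G; lra.
have Gub x : has_ubound [set G a x | a in A].
  have [a Aa] := A0; exists (phi a + k * mdist a x) => _ [b Ab <-].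
  exact: phiG.
exists (fun z => sup [set G a z | a in A]); split.
  by apply: sup_lipschitz => // a _; exact: Gk.
move=> a Aa; apply/eqP; rewrite eq_le; apply/andP; split.
  apply: ge_sup; first by have [b Ab] := A0; exists (G b a), b.
  by move=> _ [b Ab <-]; have := phiG a b a Aa Ab; rewrite mdistxx mulr0 addr0.
by apply: (ub_le_sup (Gub a)); exists a => //; rewrite /G mdistxx mulr0 subr0.
Qed.

End lipschitz_extension.

(** * A test function with oscillating slopes *)

Section oscillation.
Context {R : realType} {M : metricType R} (o : M).
Hypotheses (Mseg : segments M) (Mcompact : compact [set: M]).
Hypothesis Mnontrivial : exists x, x != o.

(** [h] is a supremum of bumps at the [u n] with [n] even, supported in disjoint balls. Height and
    radius [mdist (u n) (v n)] give slope 1 along the pair; without a bump the slope is 0. *)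
Lemma slopes_oscillate (f : Lip0 o) : exists h : Lip0 o, forall eps : R, 0 < eps ->
  (exists u v, slope_above f eps u v /\ molecule o u v h = 1) /\
  (exists u v, slope_above f eps u v /\ molecule o u v h = 0).
Proof.
(* [n.+2] keeps [e n] strictly below 1, which puts [v n] inside the n-th ball. *)
pose e n : R := n.+2%:R^-1.
have e0 n : 0 < e n by rewrite invr_gt0.
have e1 n : e n < 1 by rewrite invf_lt1// ltr1n.
have [u [v [rho [fuv duv disj]]]] := slope_above_disjoint Mseg Mcompact Mnontrivial f e0.
have D0 n : 0 < mdist (u n) (v n) by have [uv _] := fuv n; rewrite mdist_gt0.
have rho0 n : 0 < rho n.
  by have := lt_le_trans (D0 n) (duv n); rewrite pmulr_rgt0.
have Drho n : mdist (u n) (v n) < rho n.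
  by apply: le_lt_trans (duv n) _; rewrite gtr_pMl.
pose G n z := if odd n then 0 else Num.max (mdist (u n) (v n) - mdist (u n) z) 0.
have Glip n x y : `|G n x - G n y| <= 1 * mdist x y.
  rewrite mul1r /G; case: odd; first by rewrite subrr normr0 mdist_ge0.
  have := mdist_lipschitz (u n) x (u n) y; rewrite mdistxx add0r !ler_norml.
  move=> /andP[l1 l2]; have d0 := mdist_ge0 x y.
  by case: (leP (_ - mdist _ x)) => h1; case: (leP (_ - mdist _ y)) => h2;
    apply/andP; split; lra.
have Gge0 n z : 0 <= G n z by rewrite /G; case: odd; rewrite ?le_max lexx ?orbT.
have [B dB] := mdist_bounded o Mcompact.
have Gub z : has_ubound [set G n z | n in [set: nat]].
  exists B => _ [n _ <-]; rewrite /G.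
  have B0 : 0 <= B by rewrite -(mdistxx z).
  case: odd => //; rewrite ge_max B0 andbT.
  by have := dB (u n) (v n); have := mdist_ge0 (u n) z; lra.
pose H z := sup [set G n z | n in [set: nat]].
have Hlip := sup_lipschitz (A := [set: nat]) (ex_intro _ 0%N I) (fun n _ => Glip n) Gub.
have HE n z : mdist (u n) z < rho n -> H z = G n z.
  move=> nz; apply/eqP; rewrite eq_le; apply/andP; split; last first.
    by apply: (ub_le_sup (Gub z)); exists n.
  apply: ge_sup; first by exists (G n z), n.
  move=> _ [m _ <-]; have [<-//|mn] := eqVneq m n.
  suff -> : G m z = 0 by exact: Gge0.
  rewrite /G; case: odd => //; case: leP => // lt; exfalso.
  have mz : mdist (u m) z < rho m by apply: lt_trans (Drho m); lra.
  by move: mn; rewrite (disj m n z mz nz) eqxx.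
have Hu n : H (u n) = if odd n then 0 else mdist (u n) (v n).
  rewrite (HE n) ?mdistxx// /G mdistxx subr0; case: odd => //.
  by rewrite max_l// ltW.
have Hv n : H (v n) = 0.
  by rewrite (HE n)// /G subrr maxxx; case: odd.
have [h hE] := lip0_ex o Hlip.
have {}hE z : h z = H z - H o by exact: hE.
have hmol n : molecule o (u n) (v n) h = if odd n then 0 else 1.
  rewrite moleculeE !hE opprB addrA subrK Hu Hv subr0.
  by case: odd; rewrite ?mulr0// mulVf// gt_eqF.
exists h => eps eps0.
have [n ne] : exists n, e n.*2 < eps /\ e n.*2.+1 < eps.
  have [n _ nP] := near_infty_natSinv_lt (PosNum eps0).
  have key m : (n <= m)%N -> e m < eps.
    move=> nm; have /= := nP m.+1; apply; exact: leq_trans nm _.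
  exists n; split; apply: key; rewrite -addnn ?leq_addr//.
  by rewrite -addSn leq_addl.
have slope m : e m < eps -> slope_above f eps (u m) (v m).
  move=> me; have [uv lt] := fuv m; split=> //; apply: le_lt_trans lt.
  by rewrite ler_wpM2r ?mdist_ge0// lerD2l lerN2 ltW.
have [ne1 ne2] := ne; split.
- exists (u n.*2), (v n.*2); split; first exact: slope.
  by rewrite hmol odd_double.
- exists (u n.*2.+1), (v n.*2.+1); split; first exact: slope.
  by rewrite hmol /= odd_double.
Qed.

End oscillation.
(** One half of Smulyan's criterion. [N f + t * N h] is at most the norm of [f + t *: h]; for a
    fixed small [t], the difference quotient and the defect of [N] at [f] each contribute
    [eta / 2]. *)
Lemma gateaux_dual_le (R : realType) (X : normedModType R) (f : X)
    (L : dual X) (h : X) (eta : R) :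
  is_derive f h (norm_fun X) (L h) -> 0 < eta ->
  exists2 delta : R, 0 < delta & forall N : dual X, `|N| <= 1 ->
    `|f| - delta < N f -> N h <= L h + eta.
Proof.
move=> [der derE] eta0.
have cvgL : (fun t : R => t^-1 *: ((norm_fun X \o shift f) (t *: h) - norm_fun X f))
    @ 0^' --> (L h : R^o) by rewrite -derE; exact: der.
have eta2 : 0 < eta / 2 by rewrite divr_gt0.
move/cvgrPdist_le : cvgL => /(_ _ eta2) [r /= r0 rP].
pose t := r / 2; have t0 : 0 < t by rewrite divr_gt0.
exists (t * (eta / 2)) => [|N N1 Nf]; first by rewrite mulr_gt0.
have := rP t; rewrite /= sub0r normrN gtr0_norm// => /(_ _ _).
have tr : t < r by rewrite /t; lra.
move=> /(_ tr); rewrite gt_eqF// => /(_ isT).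
rewrite ler_norml => /andP[+ _].
rewrite /norm_fun/= lerBrDl -[_ *: _]/(_ * _) lerBlDr mulrC ler_pdivrMr// => le.
have := dual_ball_le (t *: h + f) N1; rewrite dual_addE dual_scaleE => le2.
by rewrite -(ler_pM2l t0); lra.
Qed.

(** * Absence of Gateaux points and of strongly exposed points *)

Section geodesic_consequences.
Context {R : realType} {M : metricType R} (o : M).
Hypotheses (Mseg : segments M) (Mcompact : compact [set: M]).
Hypothesis Mnontrivial : exists x, x != o.

Lemma slope_above_molecule (f : Lip0 o) (eps : R) u v : slope_above f eps u v ->
  `|f| - eps < molecule o u v f.
Proof.
move=> [uv lt]; rewrite -(@ltr_pM2r _ (mdist u v)) ?mdist_gt0//.
by rewrite moleculeK.
Qed.

(** Almost norming molecules with value 1 at [h] force [L h >= 3 / 4], those with value 0 force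
    [L h <= 1 / 4]. *)
Lemma not_gateaux (f : Lip0 o) : ~ gateaux_differentiable (norm_fun (Lip0 o)) f.
Proof.
move=> [L LP].
have [h hP] := slopes_oscillate Mseg Mcompact Mnontrivial f.
have e4 : (0 : R) < 4^-1 by rewrite invr_gt0.
have [d1 d10 d1P] := gateaux_dual_le (LP h) e4.
have [d2 d20 d2P] := gateaux_dual_le (LP (- h)) e4.
have [[u [v [/slope_above_molecule fuv huv]]] _] := hP _ d10.
have [_ [u' [v' [/slope_above_molecule fuv' huv']]]] := hP _ d20.
have := d1P _ (norm_molecule_le1 o u v) fuv.
have := d2P _ (norm_molecule_le1 o u' v') fuv'.
rewrite [in X in X <= _]dual_oppE [in X in _ <= X]dual_oppE huv huv'.
lra.
Qed.

(** [f x] is the value of [phi] at the evaluation in [x]. The two bounded functionals agree on the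
    span of these evaluations, which is dense. *)
Lemma dual_free (phi : dual (FreeSpace o)) : exists f : Lip0 o, phi = evaluation f.
Proof.
pose fd x : FreeSpace o := MkFreeSpace (delta_in_free o x).
have [|f fE] := @lip0_ex R M o (fun x => phi (fd x)) `|phi|.
  move=> x y; rewrite -dual_subE; apply: le_trans (dualE_norm _ _) _.
  rewrite ler_wpM2l//; apply: dual_norm_le; first exact: mdist_ge0.
  move=> h; apply: le_trans (ler_norm _) _.
  rewrite mulrC; exact: norm_lip0.
have fdo : fd o = 0.
  by apply/val_inj/val_inj/funext => h /=; exact: lip0_base.
have {}fE x : f x = phi (fd x) by rewrite fE fdo dual_zeroE subr0.
exists f; apply/val_inj/funext => n /=.
apply/eqP; rewrite -subr_eq0 -normr_le0; apply/ler_addgt0Pr => e e0; rewrite add0r.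
have : closure (lin_span (range (delta o))) (free_val n).
  by case: n => n /=; rewrite inE.
have k0 : 0 < e / (`|phi| + `|f| + 1).
  by rewrite divr_gt0// ltr_wpDl// addr_ge0.
move=> /(_ _ (nbhsx_ballx _ _ k0))[_ [[d [a [w [wd ->]]]]]].
rewrite -ball_normE /= => nw.
have wfd i : exists x, w i = free_val (fd x).
  by have [x _ <-] := wd i; exists x.
have [xs xsE] := choice wfd.
pose n' : FreeSpace o := \sum_(i < d) a i *: fd (xs i).
have n'E : free_val n' = \sum_(i < d) a i *: w i.
  rewrite (big_morph (@free_val R M o) (id1 := 0) (op1 := +%R))//.
  by apply: eq_bigr => i _; rewrite xsE.
have phin' : phi n' = free_val n' f.
  rewrite -[RHS]/(evaluation f n') /n' !dual_sumE; apply: eq_bigr => i _.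
  by rewrite !dual_scaleE -fE.
have -> : phi n - free_val n f = phi (n - n') - free_val (n - n') f.
  rewrite dual_subE phin' -[free_val (n - n') f]/(free_val n f - free_val n' f).
  by rewrite opprB addrA subrK.
have nn' : `|n - n'| < e / (`|phi| + `|f| + 1) by rewrite free_normE/= n'E.
apply: le_trans (ler_normB _ _) _.
have := dualE_norm phi (n - n').
have := dualE_norm (free_val (n - n')) f; rewrite -free_normE.
move: nn'; rewrite ltr_pdivlMr; last by rewrite ltr_wpDl// addr_ge0.
have := normr_ge0 (n - n'); lra.
Qed.

(** Multiples by [c] of molecules with value 1 at [h], and of others with value 0, converge to [m].
    Hence [c = free_val m h = 0], and [m] would vanish. *)
Lemma not_strongly_exposed (m : FreeSpace o) : ~ strongly_exposed_point m.
Proof.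
move=> [/= m1 [phi /= phi1 phiP]].
have [f phiE] := dual_free phi; rewrite phiE in phi1 phiP.
have f1 : 1 <= `|f| by rewrite -phi1 norm_evaluation_le.
have f0 : 0 < `|f| by exact: lt_le_trans f1.
have [h hP] := slopes_oscillate Mseg Mcompact Mnontrivial f.
pose e n : R := n.+1%:R^-1.
have e0 n : 0 < e n by rewrite invr_gt0.
pose c := free_val m f / `|f|.
have c1 : `|c| <= 1.
  rewrite normrM normfV normr_id ler_pdivrMr// mul1r.
  by apply: le_trans (dualE_norm _ _) _; rewrite -free_normE m1 mul1r.
(* The value of [phi] at [m] is not known to be 1; the factor [c] makes the values at [f] converge
   to [free_val m f] in any case. *)
have limit (u v : nat -> M) : (forall n, slope_above f (e n) (u n) (v n)) ->
    c *: free_molecule o (u n) (v n) @[n --> \oo] --> m.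
  move=> fuv; apply: phiP => [n|].
    rewrite /unit_ball/= normrZ mulr_ile1//; exact: norm_molecule_le1.
  rewrite [X in _ --> X](_ : _ = c * `|f|); last first.
    by rewrite /c divfK// gt_eqF.
  under eq_fun do rewrite dual_scaleE evaluationE free_moleculeE.
  apply: cvgMl_tmp; apply/cvgrPdist_le => eps eps0; near=> n.
  have lt := slope_above_molecule (fuv n).
  have le := molecule_le_norm (u n) (v n) f.
  have {}le := le_trans (ler_norm _) le.
  have en : e n < eps by near: n; exact: near_infty_natSinv_lt (PosNum eps0).
  by rewrite ger0_norm ?subr_ge0//; lra.
have /choice[w wP] n : exists w : M * M,
    slope_above f (e n) w.1 w.2 /\ molecule o w.1 w.2 h = 1.
  by have [[u [v uv]] _] := hP _ (e0 n); exists (u, v).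
have /choice[w' w'P] n : exists w : M * M,
    slope_above f (e n) w.1 w.2 /\ molecule o w.1 w.2 h = 0.
  by have [_ [u [v uv]]] := hP _ (e0 n); exists (u, v).
have evc := @blin_continuous R (FreeSpace o) R^o (evaluation h).
have cvgev (z : nat -> FreeSpace o) : z @ \oo --> m ->
    evaluation h (z n) @[n --> \oo] --> free_val m h.
  by move=> zm; exact: (continuous_cvg _ (evc m) zm).
have lim1 : free_val m h = c.
  have /cvgev := limit _ _ (fun n => (wP n).1).
  under eq_fun do rewrite dual_scaleE evaluationE free_moleculeE (wP _).2 mulr1.
  by move=> /cvg_lim <- //; rewrite lim_cst.
have lim0 : free_val m h = 0.
  have /cvgev := limit _ _ (fun n => (w'P n).1).
  under eq_fun do rewrite dual_scaleE evaluationE free_moleculeE (w'P _).2 mulr0.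
  by move=> /cvg_lim <- //; rewrite lim_cst.
have c0 : c = 0 by rewrite -lim1.
have := limit _ _ (fun n => (wP n).1).
under eq_fun do rewrite c0 scale0r.
move=> /cvg_lim => /(_ (@norm_hausdorff _ _)); rewrite lim_cst// => m0.
have nm0 : `|m| = 0 by rewrite -m0; exact: normr0.
by move/eqP: m1; rewrite nm0 eq_sym oner_eq0.
Unshelve. all: by end_near. Qed.

End geodesic_consequences.

(** * The Daugavet property *)

Section daugavet.
Context {R : realType} {M : metricType R} (o : M).
Implicit Types (f g : Lip0 o).

(** The increment from [z] to [w] involves only the summands whose set contains [z] or [w], at most
    one for each point. *)
Lemma disjoint_sum_norm (N : nat) (k : 'I_N -> Lip0 o) (B : 'I_N -> set M) (K : R) :
  0 <= K -> (forall i, `|k i| <= K) ->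
  (forall i j z, B i z -> B j z -> i = j) ->
  (forall i z w, ~ B i z -> ~ B i w -> k i z = k i w) ->
  `|\sum_i k i| <= 2 * K.
Proof.
move=> K0 kK Bdisj kB.
have ind z : \sum_i (`[< B i z >]%:R : R) <= 1.
  have [[i Biz]|nB] := pselect (exists i, B i z).
    rewrite (bigD1 i)//= big1 ?addr0; first by case: asboolP => _; rewrite ?lexx ?ler01.
    move=> j ji; case: asboolP => // Bjz.
    by move: ji; rewrite (Bdisj _ _ _ Bjz Biz) eqxx.
  rewrite big1 ?ler01// => i _; case: asboolP => // Biz.
  by exfalso; apply: nB; exists i.
apply: norm_lip0_le => [|z w]; first by rewrite mulr_ge0.
have d0 := mdist_ge0 z w.
have Kd : 0 <= K * mdist z w by rewrite mulr_ge0.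
rewrite !lip0_sum -sumrB; apply: le_trans (ler_norm_sum _ _ _) _.
apply: (@le_trans _ _ (\sum_i ((`[< B i z >]%:R + `[< B i w >]%:R) : R) * (K * mdist z w))).
  apply: ler_sum => i _.
  have kzw : `|k i z - k i w| <= K * mdist z w.
    by rewrite (le_trans (norm_lip0 _ _ _))// ler_wpM2r.
  case: asboolP => Bz; case: asboolP => Bw.
  - by apply: le_trans kzw _; rewrite ler_peMl// lerDl ler01.
  - by rewrite addr0 mul1r.
  - by rewrite add0r mul1r.
  - by rewrite (kB i z w Bz Bw) subrr normr0 addr0 mul0r.
rewrite -mulr_suml big_split/= -mulrA ler_wpM2r//.
by have := ind z; have := ind w; lra.
Qed.

(** Prescribe [f v + mdist u v] at [u], keep [f] at [v] and outside the ball, and extend. Seen from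
    outside, the new value costs at most [2 * mdist u v <= delta * rho], over distances at least
    [rho]. *)
Lemma steep_modification f (delta rho : R) u v : `|f| <= 1 -> 0 < delta ->
  u != v -> 2 * mdist u v <= delta * rho -> mdist u v < rho ->
  exists g, [/\ `|g| <= 1 + delta, g u - g v = mdist u v &
    forall z w, ~ mdist u z < rho -> ~ mdist u w < rho ->
      (g - f) z = (g - f) w].
Proof.
move=> f1 delta0 uv duv dr; have D0 : 0 < mdist u v by rewrite mdist_gt0.
pose phi z : R := if z == u then f v + mdist u v else f z.
pose A := [set z | rho <= mdist u z] `|` [set u; v].
have phiu : phi u = f v + mdist u v by rewrite /phi eqxx.
have phiN z : z != u -> phi z = f z by rewrite /phi => /negPf ->.
have fl x y : `|f x - f y| <= mdist x y.
  by rewrite (le_trans (norm_lip0 _ _ _))// ler_piMl// mdist_ge0.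
have k0 : 0 <= 1 + delta by rewrite addr_ge0// ltW.
have ge1 x y : mdist x y <= (1 + delta) * mdist x y.
  by rewrite ler_peMl ?mdist_ge0// lerDl ltW.
have uA z : A z -> z != u -> `|phi u - phi z| <= (1 + delta) * mdist u z.
  move=> Az zu; rewrite phiu phiN//; case: Az => [/= rz|[zu'|->]].
  - have := fl v z; have := metric_triangle v u z; rewrite (metric_sym v u).
    have : delta * rho <= delta * mdist u z by rewrite ler_pM2l.
    by rewrite !ler_norml => ? ? /andP[? ?]; apply/andP; split; lra.
  - by move: zu; rewrite zu' eqxx.
  - by rewrite addrAC subrr add0r gtr0_norm.
have [||F [Flip FA]] := @lipschitz_extension R M A phi (1 + delta) _ k0.
- by exists u; right; left.
- move=> a b Aa Ab; have [->|au] := eqVneq a u.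
    have [->|bu] := eqVneq b u; last exact: uA.
    by rewrite subrr normr0 mulr_ge0// mdist_ge0.
  have [->|bu] := eqVneq b u; first by rewrite distrC metric_sym uA.
  by rewrite !phiN// (le_trans (fl _ _)).
have [g gE] := lip0_ex o Flip.
have gB x y : g x - g y = F x - F y by rewrite !gE opprB addrA subrK.
exists g; split.
- by apply: norm_lip0_le => // x y; rewrite gB.
- rewrite gB !FA ?phiu; [|by right; right|by right; left].
  by rewrite phiN 1?eq_sym// addrC addKr.
- have far z : ~ mdist u z < rho -> F z = f z.
    move=> /negP; rewrite -leNgt => rz; rewrite FA ?phiN//; last by left.
    by apply/eqP => zu; move: rz; rewrite zu mdistxx; lra.
  by move=> z w /far Fz /far Fw; rewrite !lip0B !gE Fz Fw; lra.
Qed.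

Hypotheses (Mseg : segments M) (Mcompact : compact [set: M]).
Hypothesis Mnontrivial : exists x, x != o.

(** With [T g = c g *: y], some [g] of norm at most [1 + eps] has [T g] almost of norm [tau] and
    slope 1 at a pair where [y] is almost steepest. There [T g + g] has slope close to [tau + 1]. *)
Lemma segments_daugavet : daugavet_property (Lip0 o).
Proof.
move=> T [y y0 Ty].
apply/eqP; rewrite eq_le; apply/andP; split.
  apply: le_trans (ler_normD _ _) _; rewrite [leLHS]addrC lerD2r.
  by apply: blin_norm_le.
set S := `|T + blin_id _|; rewrite leNgt; apply/negP => Slt.
have Y0 : 0 < `|y| by rewrite normr_gt0.
have [x0 yx0] : exists x, y x != 0.
  apply: contrapT => /forallNP ny; move/eqP: y0; apply.
  by apply/val_inj/funext => x /=; apply/eqP/negPn/negP; exact: ny.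
pose c g : R := T g x0 / y x0.
have Tc g : T g = c g *: y.
  have [a _ aE] : range (fun c : R => c *: y) (T g) by rewrite -Ty; exists g.
  by rewrite /c -aE lip0Z mulfK.
have cD a f g : c (a *: f + g) = a * c f + c g.
  by rewrite /c linearP lip0D lip0Z mulrDl mulrA.
have tau0 : 0 < `|T|.
  rewrite normr_gt0; apply/eqP => T0.
  have [g _] : range T y by rewrite Ty; exists 1 => //; rewrite scale1r.
  by rewrite T0 => /esym E; move/eqP: y0.
clear Ty; have S0 : 0 <= S by exact: normr_ge0.
set tau := `|T| in Slt tau0 *.
pose gap := 1 + tau - S; have gap0 : 0 < gap by rewrite subr_gt0.
have den0 : 0 < 4 * (S + 3 * tau + 1) by lra.
(* The final estimate loses at most [(S + 3 * tau) * eps], less than [gap]; the remaining constants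
   ensure [eps <= 1 / 4]. *)
pose eps := gap / (4 * (S + 3 * tau + 1)).
have eps0 : 0 < eps by rewrite divr_gt0.
have epsE : eps * (4 * (S + 3 * tau + 1)) = gap by rewrite /eps divfK// gt_eqF.
have eps4 : eps <= 4^-1.
  by rewrite /eps ler_pdivrMr//; rewrite /gap; lra.
have te : 0 < tau * eps by rewrite mulr_gt0.
have [f f1 cf] : exists2 f : Lip0 o, `|f| <= 1 & tau * (1 - eps) < c f * `|y|.
  have [_ [f /= f1 <-]] := sup_adherent te (blin_norm_has_sup T).
  rewrite -[sup _]/(`|T|) -/tau Tc normrZ => lt.
  have [cf|cf] := leP 0 (c f).
    by exists f => //; move: lt; rewrite ger0_norm//; lra.
  exists (- f); first by rewrite normrN.
  have -> : c (- f) = - c f.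
    by have := cD (-1) f 0; rewrite scaleN1r addr0 mulN1r => ->; rewrite /c linear0 mul0r addr0.
  by move: lt; rewrite ltr0_norm//; lra.
have Ye : 0 < `|y| * eps by rewrite mulr_gt0.
pose ee (n : nat) : R := Num.min (`|y| * eps) (eps / 2).
have ee0 n : 0 < ee n by rewrite lt_min Ye divr_gt0.
have [u [v [rho [yuv duv disj]]]] :=
  slope_above_disjoint Mseg Mcompact Mnontrivial y ee0.
have /choice[g gP] n : exists g, [/\ `|g| <= 1 + eps, g (u n) - g (v n) = mdist (u n) (v n) &
    forall z w, ~ mdist (u n) z < rho n -> ~ mdist (u n) w < rho n ->
      (g - f) z = (g - f) w].
  have [uv _] := yuv n.
  have D0 : 0 < mdist (u n) (v n) by rewrite mdist_gt0.
  have rho0 : 0 < rho n by have := lt_le_trans D0 (duv n); rewrite pmulr_rgt0.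
  have le : mdist (u n) (v n) <= eps / 2 * rho n.
    by apply: le_trans (duv n) _; rewrite ler_pM2r// ge_min lexx orbT.
  have er : eps * rho n <= 4^-1 * rho n by rewrite ler_pM2r.
  by apply: steep_modification => //; lra.
(* [2 * (2 + eps)] bounds the sum of any number of the differences [g n - f], so the mean of [N] of
   them has norm at most [eps]. *)
have [N N0 NP] : exists2 N : nat, (0 < N)%N & 2 * (2 + eps) / N%:R <= eps.
  have k0 : 0 < eps / (2 * (2 + eps)) by rewrite divr_gt0// mulr_gt0//; lra.
  have [n _ nP] := near_infty_natSinv_lt (PosNum k0).
  exists n.+1 => //; have /= := nP n (leqnn n).
  rewrite ltr_pdivlMr; last by lra.
  by rewrite mulrC => /ltW.
have N0' : (0 : R) < N%:R by rewrite ltr0n.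
pose k (i : 'I_N) := g i - f.
have sumk : `|\sum_i k i| <= 2 * (2 + eps).
  apply: (@disjoint_sum_norm _ _ (fun i => [set z | mdist (u i) z < rho i])).
  - by lra.
  - move=> i; apply: le_trans (ler_normB _ _) _; have [gi _ _] := gP i; lra.
  - by move=> i j z zi zj; apply/val_inj; exact: disj zi zj.
  - by move=> i z w zi wi; have [_ _] := gP i; apply.
have csum (F : 'I_N -> Lip0 o) : c (\sum_i F i) = \sum_i c (F i).
  have c0 : c 0 = 0 by rewrite /c linear0 mul0r.
  apply: (big_morph c) => // a b.
  by have := cD 1 a b; rewrite scale1r mul1r.
(* The mean of the [g i] is within [eps] of [f], so the [c (g i)] cannot all be much smaller than
   [c f]. *)
have [i ci] : exists i : 'I_N, tau * (1 - 2 * eps) <= c (g i) * `|y|.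
  apply: contrapT => /forallNP nci.
  have lt : \sum_(i < N) c (g i) * `|y| <= \sum_(i < N) tau * (1 - 2 * eps).
    by apply: ler_sum => i _; rewrite ltW// ltNge; exact/negP.
  have : `|T (\sum_i k i)| <= tau * (2 * (2 + eps)).
    by apply: le_trans (ler_blin_norm _ _) _; rewrite ler_wpM2l// ltW.
  rewrite Tc normrZ csum => le.
  have ck i : c (k i) = c (g i) - c f.
    by rewrite /k addrC -scaleN1r cD mulN1r addrC.
  have ckE : \sum_i c (k i) = \sum_(i < N) c (g i) - c f * N%:R.
    under eq_bigr do rewrite ck.
    by rewrite sumrB sumr_const card_ord mulr_natr.
  have {}le : - (tau * (2 * (2 + eps))) <= (\sum_(i < N) c (g i) - c f * N%:R) * `|y|.
    rewrite lerNl -ckE -mulNr; apply: le_trans _ le.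
    by rewrite ler_wpM2r// -[leRHS]normrN ler_norm.
  move: lt; rewrite -mulr_suml sumr_const card_ord -[leRHS]mulr_natr => lt.
  have cfN : tau * (1 - eps) * N%:R < c f * `|y| * N%:R by rewrite ltr_pM2r.
  have NP2 : tau * (2 * (2 + eps)) <= tau * (eps * N%:R).
    by rewrite ler_pM2l//; move: NP; rewrite ler_pdivrMr.
  lra.
have [gi guv _] := gP i; have [uv yuvi] := yuv i.
have D0 : 0 < mdist (u i) (v i) by rewrite mdist_gt0.
have c0 : 0 < c (g i).
  rewrite -(pmulr_lgt0 _ Y0); apply: lt_le_trans ci.
  by rewrite mulr_gt0//; lra.
have yslope : (1 - eps) * `|y| * mdist (u i) (v i) < y (u i) - y (v i).
  apply: le_lt_trans yuvi; rewrite ler_wpM2r ?(ltW D0)//.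
  have : ee i <= `|y| * eps by rewrite ge_min lexx.
  lra.
have := norm_lip0 ((T + blin_id _) (g i)) (u i) (v i).
have -> : (T + blin_id _) (g i) = c (g i) *: y + g i by rewrite -Tc.
rewrite !lip0D !lip0Z opprD addrACA guv -mulrBr => le.
have le2 := le_trans (ler_norm _) le.
have le3 : `|c (g i) *: y + g i| <= S * (1 + eps).
  rewrite -Tc -[T _ + _]/((T + blin_id _) (g i)).
  by apply: le_trans (ler_blin_norm _ _) _; rewrite ler_wpM2l.
have le4 : c (g i) * ((1 - eps) * `|y| * mdist (u i) (v i)) <= c (g i) * (y (u i) - y (v i)).
  by rewrite ler_pM2l// ltW.
have le5 : tau * (1 - 2 * eps) * (1 - eps) <= c (g i) * `|y| * (1 - eps).
  by rewrite ler_wpM2r//; lra.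
have le6 : c (g i) * `|y| * (1 - eps) + 1 <= S * (1 + eps).
  rewrite -(ler_pM2r D0); apply: le_trans (_ : _ <= `|c (g i) *: y + g i| * mdist (u i) (v i)) _.
    by apply: le_trans le2; lra.
  by rewrite ler_pM2r.
have ee2 : 0 < tau * eps * eps := mulr_gt0 te eps0.
have Se : 0 <= S * eps := mulr_ge0 S0 (ltW eps0).
by move: epsE; rewrite /gap => epsE; lra.
Qed.

End daugavet.
(** * Preserved extreme points *)

Section hahn_banach.
Context {R : realType} (V : lmodType R).
Implicit Types (p q : V -> R) (x y : V).

Definition sublinear p := (forall x y, p (x + y) <= p x + p y) /\
  (forall (a : R) x, 0 < a -> p (a *: x) <= a * p x).

Lemma sublinear0 p : sublinear p -> p 0 = 0.
Proof.
move=> [pD pZ]; have h2 : (0 : R) < 2^-1 by rewrite invr_gt0.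
have := pD 0 0; have := pZ _ 0 h2; rewrite scaler0 addr0.
by move=> ? ?; apply/eqP; rewrite eq_le; apply/andP; split; lra.
Qed.

Lemma sublinearZ p (a : R) x : sublinear p -> 0 < a -> p (a *: x) = a * p x.
Proof.
move=> [pD pZ] a0; apply/eqP; rewrite eq_le pZ//=.
have := pZ a^-1 (a *: x); rewrite invr_gt0 scalerA mulVf ?gt_eqF// scale1r.
by move=> /(_ a0); rewrite mulrC ler_pdivlMr// mulrC.
Qed.

Lemma sublinear_geN p x : sublinear p -> - p (- x) <= p x.
Proof.
move=> psub; have := psub.1 x (- x); rewrite subrr (sublinear0 psub).
by rewrite lerNl addrC -lerBlDr sub0r.
Qed.

(* By minimality, [p] agrees with [z |-> inf_(t >= 0) p (z + t *: y) - t * p y];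
   taking [t = 1] shows that [p] is superadditive. *)
Lemma minimal_sublinear_linear p : sublinear p ->
  (forall q, sublinear q -> (forall x, q x <= p x) -> q = p) ->
  forall (a : R) x y, p (a *: x + y) = a * p x + p y.
Proof.
move=> psub pmin; have [pD pZ] := psub.
have pDE x y : p (x + y) = p x + p y.
  apply/eqP; rewrite eq_le pD/=.
  pose A z := [set p (z + t *: y) - t * p y | t in [set t | 0 <= t]].
  have Alb z : lbound (A z) (- p (- z)).
    move=> _ [t /= t0 <-]; have := pD (z + t *: y) (- z); rewrite addrAC subrr add0r.
    suff -> : p (t *: y) = t * p y by lra.
    move: t0; rewrite le_eqVlt => /predU1P[<-|t0]; last exact: sublinearZ.
    by rewrite scale0r mul0r sublinear0.
  have Ainf z : has_inf (A z).
    split; last by exists (- p (- z)); exact: Alb.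
    by exists (p (z + 0 *: y) - 0 * p y), 0 => //=.
  have Ale z t : 0 <= t -> inf (A z) <= p (z + t *: y) - t * p y.
    by move=> t0; apply: (ge_inf (Ainf z).2); exists t.
  have qsub : sublinear (fun z => inf (A z)).
    split=> [z w|b z b0] /=.
      rewrite -lerBlDr; apply: lb_le_inf; first exact: (Ainf z).1.
      move=> _ [t /= t0 <-]; rewrite lerBlDr [leRHS]addrC -lerBlDr.
      apply: lb_le_inf; first exact: (Ainf w).1.
      move=> _ [s /= s0 <-]; rewrite lerBlDr.
      apply: le_trans (Ale (z + w) (t + s) (addr_ge0 t0 s0)) _.
      have := pD (z + t *: y) (w + s *: y); rewrite addrACA -scalerDl; lra.
    rewrite mulrC -ler_pdivrMr//; apply: lb_le_inf; first exact: (Ainf z).1.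
    move=> _ [t /= t0 <-]; rewrite ler_pdivrMr//.
    apply: le_trans (Ale _ (b * t) _) _; first by rewrite mulr_ge0// ltW.
    by rewrite -scalerA -scalerDr sublinearZ//; lra.
  have qp : (fun z => inf (A z)) = p.
    apply: pmin => // z; have := Ale z 0 (lexx _).
    by rewrite scale0r mul0r addr0 subr0.
  have := Ale x 1 ler01; rewrite scale1r mul1r -[inf (A x)]/((fun z => inf (A z)) x).
  by rewrite qp lerBrDr.
have pN x : p (- x) = - p x.
  by apply/eqP; rewrite -addr_eq0 -pDE addNr sublinear0.
move=> a x y; rewrite pDE; congr (_ + _).
have [a0|a0|->] := ltgtP a 0; last by rewrite scale0r mul0r sublinear0.
  rewrite -[a *: x]opprK pN -scaleNr sublinearZ ?oppr_gt0//.
  by rewrite mulNr opprK.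
exact: sublinearZ.
Qed.

(** Zorn's lemma, for the sublinear functionals below [p] ordered downwards, gives a minimal one,
    which is linear. Infima of chains are finite, since [- p (- x)] is a lower bound at [x]. *)
Lemma linear_below_sublinear p : sublinear p -> exists b : V -> R,
  (forall (a : R) x y, b (a *: x + y) = a * b x + b y) /\ forall x, b x <= p x.
Proof.
move=> psub.
pose T := {q : V -> R | sublinear q /\ forall x, q x <= p x}.
pose mk q (qP : sublinear q /\ forall x, q x <= p x) : T := exist _ q qP.
pose below (q r : T) := `[< forall x, sval r x <= sval q x >].
have [||||[q [qsub qp]] qmin] := @Zorn T below.
- by move=> q; apply/asboolP => x.
- move=> q r s /asboolP qr /asboolP rs; apply/asboolP => x.
  exact: le_trans (rs x) (qr x).
- move=> [q qP] [r rP] /asboolP/= qr /asboolP/= rq.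
  by apply: eq_exist; apply/funext => x; apply/eqP; rewrite eq_le rq qr.
- move=> A Atot; have [[q0 Aq0]|nA] := pselect (exists r, A r); last first.
    by exists (mk p (conj psub (fun=> lexx _))) => q Aq; exfalso; apply: nA; exists q.
  pose B x := [set sval r x | r in A].
  have Binf x : has_inf (B x).
    split; first by exists (sval q0 x), q0.
    exists (- p (- x)) => _ [[q [qsub qp]] _ <-] /=.
    by apply: le_trans (sublinear_geN x qsub); rewrite lerN2.
  have Ble x r : A r -> inf (B x) <= sval r x.
    by move=> Ar; apply: (ge_inf (Binf x).2); exists r.
  have tsub : sublinear (fun x => inf (B x)).
    split=> [x y|a x a0] /=.
      rewrite -lerBlDr; apply: lb_le_inf; first exact: (Binf x).1.
      move=> _ [q Aq <-]; rewrite lerBlDr [leRHS]addrC -lerBlDr.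
      apply: lb_le_inf; first exact: (Binf y).1.
      move=> _ [r Ar <-]; rewrite lerBlDr.
      case: (Atot _ _ Aq Ar) => /asboolP le.
        apply: le_trans (Ble _ _ Ar) _; apply: le_trans ((svalP r).1.1 _ _) _.
        by rewrite addrC lerD2l.
      apply: le_trans (Ble _ _ Aq) _; apply: le_trans ((svalP q).1.1 _ _) _.
      by rewrite addrC lerD2r.
    rewrite mulrC -ler_pdivrMr//; apply: lb_le_inf; first exact: (Binf x).1.
    move=> _ [q Aq <-]; rewrite ler_pdivrMr// mulrC.
    exact: le_trans (Ble _ _ Aq) ((svalP q).1.2 _ _ a0).
  have tp x : inf (B x) <= p x := le_trans (Ble x q0 Aq0) ((svalP q0).2 x).
  by exists (mk _ (conj tsub tp)) => q Aq; apply/asboolP => x; exact: Ble.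
exists q; split=> //; apply: minimal_sublinear_linear => // r rsub rq.
have rp x : r x <= p x := le_trans (rq x) (qp x).
have := qmin (mk r (conj rsub rp)); rewrite /below => /(_ _)/(congr1 sval)/=.
by apply; apply/asboolP.
Qed.

End hahn_banach.

(** * Extreme functionals dominated by a maximum of seminorms *)

Section extreme_functionals.
Context {R : realType} (X : normedModType R).
Implicit Types (p q : X -> R) (x y f g h : X).

Definition seminorm p := [/\ forall x, 0 <= p x,
  forall x y, p (x + y) <= p x + p y & forall (a : R) x, p (a *: x) <= `|a| * p x].

Lemma bounded_linear_dual (b : X -> R) :
  (forall (a : R) x y, b (a *: x + y) = a * b x + b y) ->
  (forall x, b x <= `|x|) -> exists B : dual X, forall x, B x = b x.
Proof.
move=> blin_ bX.
have lin : linear (b : X -> R^o) by [].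
pose L := GRing.isLinear.Build R X R^o *:%R _ lin.
pose h : {linear X -> R^o} := HB.pack (b : X -> R^o) L.
have bP : (b : X -> R^o) \in blin X R^o.
  rewrite inE; split=> //; apply: (@bounded_linear_continuous R X R^o h).
  apply/linear_boundedP; near=> r => x /=.
  have r1 : 1 <= r by near: r; exact: nbhs_pinfty_ge.
  apply: (@le_trans _ _ `|x|); last by rewrite ler_peMl.
  rewrite ler_norml bX andbT lerNl.
  have := bX (- x); have := blin_ (-1) x 0; rewrite scaleN1r addr0 normrN.
  have -> : b 0 = 0.
    have := blin_ 1 0 0; rewrite scale1r addr0 mul1r => /esym/eqP.
    by rewrite -subr_eq0 addrK => /eqP.
  by rewrite mulN1r addr0 => ->.
by exists (Blin bP).
Unshelve. all: by end_near. Qed.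

(* Milman's theorem in disguise: the max-seminorm splits the functional as
   [a + b] with [a <= alpha p] and [b <= (1 - alpha) q], a convex combination. *)
Lemma extreme_split (m : dual X) p q :
  extreme_point (unit_ball (dual X)) m -> seminorm p -> seminorm q ->
  (forall x, p x <= `|x|) -> (forall x, q x <= `|x|) ->
  (forall x, `|m x| <= Num.max (p x) (q x)) ->
  (forall x, `|m x| <= p x) \/ (forall x, `|m x| <= q x).
Proof.
move=> [m1 mext] [p0 pD pZ] [q0 qD qZ] pX qX mpq.
have zero s : seminorm s -> s 0 = 0.
  move=> [s0 _ sZ]; apply/eqP; rewrite eq_le s0 andbT.
  by have := sZ 0 0; rewrite scale0r normr0 mul0r.
have [p00 q00] : p 0 = 0 /\ q 0 = 0 by split; apply: zero.
have qN x : q (- x) <= q x.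
  by have := qZ (-1) x; rewrite scaleN1r normrN1 mul1r.
(* Taking [h = g - f], a linear [b] below [inf (S h)] satisfies
   [m f - b f + b g <= Num.max (p f) (q g)], which decouples [m - b] from [b]. *)
pose S h := [set Num.max (p f) (q (f + h)) - m f | f in [set: X]].
have Slb h : lbound (S h) (- q h).
  move=> _ [f _ <-]; rewrite lerBrDl lerBlDr.
  apply: le_trans (ler_norm _) _; apply: le_trans (mpq f) _.
  have := qD (f + h) (- h); rewrite addrK => qf.
  have := qN h; have := q0 h; rewrite ge_max => ? ?.
  have : p f <= Num.max (p f) (q (f + h)) by rewrite le_max lexx.
  have : q (f + h) <= Num.max (p f) (q (f + h)) by rewrite le_max lexx orbT.
  by move=> ? ?; apply/andP; split; lra.
have Sinf h : has_inf (S h).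
  by split; [exists (Num.max (p 0) (q (0 + h)) - m 0), 0|exists (- q h); exact: Slb].
have Sle h f : inf (S h) <= Num.max (p f) (q (f + h)) - m f.
  by apply: (ge_inf (Sinf h).2); exists f.
have Ssub : sublinear (fun h => inf (S h)).
  split=> [h k|a h a0] /=.
    rewrite -lerBlDr; apply: lb_le_inf; first exact: (Sinf h).1.
    move=> _ [f _ <-]; rewrite lerBlDr [leRHS]addrC -lerBlDr.
    apply: lb_le_inf; first exact: (Sinf k).1.
    move=> _ [g _ <-]; rewrite lerBlDr.
    apply: le_trans (Sle _ (f + g)) _; rewrite dual_addE addrACA.
    suff : Num.max (p (f + g)) (q (f + h + (g + k))) <=
        Num.max (p f) (q (f + h)) + Num.max (p g) (q (g + k)) by lra.
    rewrite ge_max (le_trans (pD _ _)) ?(le_trans (qD _ _))//;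
      by rewrite lerD// le_max lexx ?orbT.
  rewrite mulrC -ler_pdivrMr//; apply: lb_le_inf; first exact: (Sinf h).1.
  move=> _ [f _ <-]; rewrite ler_pdivrMr// mulrC.
  apply: le_trans (Sle _ (a *: f)) _; rewrite dual_scaleE mulrBr lerD2r.
  rewrite -scalerDr -[X in X * _]gtr0_norm//.
  rewrite ge_max (le_trans (pZ _ _)) ?(le_trans (qZ _ _))//;
    by rewrite ler_wpM2l// le_max lexx ?orbT.
have [b [blinE bS]] := linear_below_sublinear Ssub.
have b0 : b 0 = 0.
  have := blinE 1 0 0; rewrite scale1r addr0 mul1r => /esym/eqP.
  by rewrite -subr_eq0 addrK => /eqP.
have bB g f : b (g - f) = b g - b f.
  by have := blinE (-1) f g; rewrite scaleN1r mulN1r addrC => ->; rewrite addrC.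
have ab f g : m f - b f + b g <= Num.max (p f) (q g).
  have := le_trans (bS (g - f)) (Sle _ f); rewrite bB [f + _]addrC subrK; lra.
have bq g : b g <= q g.
  by have := ab 0 g; rewrite dual_zeroE b0 subrr add0r p00 max_r.
pose a f := m f - b f.
have alinE (c : R) x y : a (c *: x + y) = c * a x + a y.
  by rewrite /a blinE dual_addE dual_scaleE; lra.
have ap f : a f <= p f by have := ab f 0; rewrite b0 addr0 q00 max_l.
have [A AE] := bounded_linear_dual alinE (fun f => le_trans (ap f) (pX f)).
have [B BE] := bounded_linear_dual blinE (fun f => le_trans (bq f) (qX f)).
have mAB f : m f = A f + B f by rewrite AE BE /a; lra.
have absA (C : dual X) s : seminorm s -> (forall f, C f <= s f) -> forall f, `|C f| <= s f.
  move=> [_ _ sZ] Cs f; rewrite ler_norml Cs andbT lerNl -dual_oppE.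
  apply: le_trans (Cs _) _; have := sZ (-1) f.
  by rewrite scaleN1r normrN1 mul1r.
pose E := [set A f | f in [set f | p f <= 1]].
have Esup : has_sup E.
  split; first by exists (A 0), 0 => //=; rewrite p00.
  by exists 1 => _ [f /= f1 <-]; rewrite AE (le_trans (ap f)).
(* [al] is the norm of [A] relative to [p]. By [ab], [A f + B g <= 1] when [p f <= 1] and
   [q g <= 1], which leaves [1 - al] for [B]. *)
pose al := sup E.
have al0 : 0 <= al.
  by apply: (ub_le_sup Esup.2); exists 0; rewrite /= ?p00 ?dual_zeroE.
have al1 : al <= 1.
  by apply: (ge_sup Esup.1) => _ [f /= f1 <-]; rewrite AE (le_trans (ap f)).
have homog (C : dual X) s (k : R) : seminorm s -> (forall f, C f <= s f) ->
    (forall f, s f <= 1 -> C f <= k) -> forall f, C f <= k * s f.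
  move=> [s0 _ sZ] Cs Ck f; have [sf|sf] := eqVneq (s f) 0.
    by rewrite sf mulr0 -sf.
  have {}sf : 0 < s f by rewrite lt_neqAle eq_sym sf s0.
  rewrite -ler_pdivrMr// mulrC -dual_scaleE; apply: Ck.
  by apply: le_trans (sZ _ _) _; rewrite gtr0_norm ?invr_gt0// mulVf// gt_eqF.
have Aal : forall f, A f <= al * p f.
  apply: homog => // [f|f f1]; first by rewrite AE.
  by apply: (ub_le_sup Esup.2); exists f.
have Bal : forall f, B f <= (1 - al) * q f.
  apply: homog => // [f|g g1]; first by rewrite BE.
  suff : al <= 1 - B g by lra.
  apply: (ge_sup Esup.1) => _ [f /= f1 <-]; rewrite lerBrDr AE BE.
  by apply: le_trans (ab f g) _; rewrite ge_max f1.
(* For [al] equal to 0 or 1 one seminorm dominates [m] at once. Otherwise extremality gives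
   [al^-1 *: A = m], which [p] dominates. *)
have [al00|aln0] := eqVneq al 0.
  right=> f; apply: (absA m q) => // {}f.
  by rewrite mAB; have := Aal f; have := Bal f; rewrite al00 mul0r subr0 mul1r; lra.
have [al11|aln1] := eqVneq al 1.
  left=> f; apply: (absA m p) => // {}f.
  by rewrite mAB; have := Aal f; have := Bal f; rewrite al11 subrr mul0r mul1r; lra.
have {}al0 : 0 < al by rewrite lt_neqAle eq_sym aln0.
have {}al1 : 0 < 1 - al by rewrite subr_gt0 lt_neqAle aln1.
have ball (C : dual X) s (k : R) : 0 < k -> (forall f, s f <= `|f|) ->
    (forall f, C f <= k * s f) -> unit_ball (dual X) (k^-1 *: C).
  move=> k0 sX Cs; apply: dual_norm_le => // f; rewrite dualZ mul1r mulrC.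
  by rewrite ler_pdivrMr// mulrC (le_trans (Cs f))// ler_pM2l.
have mE : m = al *: (al^-1 *: A) + (1 - al) *: ((1 - al)^-1 *: B).
  apply/val_inj/funext => f /=; rewrite !scalerA !divff ?gt_eqF// !scale1r.
  exact: mAB.
have al01 : 0 < al < 1 by rewrite al0 -subr_gt0 al1.
have [Am _] := mext _ _ al (ball _ _ _ al0 pX Aal) (ball _ _ _ al1 qX Bal) al01 mE.
left=> f; apply: (absA m p) => // {}f.
by rewrite -Am dualZ mulrC ler_pdivrMr// mulrC.
Qed.

End extreme_functionals.

(** * Localisation of extreme functionals *)

Section preserved_extreme_points.
Context {R : realType} {M : metricType R} (o : M).
Implicit Types (f g h : Lip0 o) (A B : set (M * M)).

(* On the diagonal the slope is [0 / 0 = 0]; adding the point [(o, o)] to [A]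
   makes the supremum meaningful for empty [A]. *)
Definition local_slope A f : R :=
  sup [set `|f p.1 - f p.2| / mdist p.1 p.2 | p in A `|` [set (o, o)]].

Let slope_ub A f : has_ubound
  [set `|f p.1 - f p.2| / mdist p.1 p.2 | p in A `|` [set (o, o)]].
Proof.
exists `|f| => _ [[u v] _ <-] /=; have [->|uv] := eqVneq u v.
  by rewrite subrr normr0 mul0r.
by rewrite ler_pdivrMr ?mdist_gt0// norm_lip0.
Qed.

Lemma local_slope_ge0 A f : 0 <= local_slope A f.
Proof.
apply: (ub_le_sup (slope_ub A f)); exists (o, o); first by right.
by rewrite /= subrr normr0 mul0r.
Qed.

Lemma local_slope_le A f (k : R) : 0 <= k ->
  (forall u v, A (u, v) -> `|f u - f v| <= k * mdist u v) -> local_slope A f <= k.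
Proof.
move=> k0 fk; apply: ge_sup.
  by exists (`|f o - f o| / mdist o o), (o, o) => //; right.
move=> _ [[u v] Auv <-] /=; have [->|uv] := eqVneq u v.
  by rewrite subrr normr0 mul0r.
rewrite ler_pdivrMr ?mdist_gt0//; case: Auv => [/fk//|[uo vo]].
by move: uv; rewrite uo vo eqxx.
Qed.

Lemma le_local_slope A f u v : A (u, v) ->
  `|f u - f v| <= local_slope A f * mdist u v.
Proof.
move=> Auv; have [->|uv] := eqVneq u v.
  by rewrite subrr normr0 mdistxx mulr0.
rewrite -ler_pdivrMr ?mdist_gt0//; apply: (ub_le_sup (slope_ub A f)).
by exists (u, v) => //; left.
Qed.

Lemma local_slope_norm A f : local_slope A f <= `|f|.
Proof. by apply: local_slope_le => // u v _; exact: norm_lip0. Qed.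

Lemma local_slope_seminorm A : seminorm (local_slope A).
Proof.
split=> [f|f g|a f]; first exact: local_slope_ge0.
  apply: local_slope_le => [|u v Auv]; first by rewrite addr_ge0 ?local_slope_ge0.
  rewrite !lip0D opprD addrACA mulrDl; apply: le_trans (ler_normD _ _) _.
  by rewrite lerD// le_local_slope.
apply: local_slope_le => [|u v Auv]; first by rewrite mulr_ge0 ?local_slope_ge0.
by rewrite !lip0Z -mulrBr normrM -mulrA ler_wpM2l// le_local_slope.
Qed.

Lemma local_slope_sub A B f : A `<=` B -> local_slope A f <= local_slope B f.
Proof.
move=> AB; apply: local_slope_le => [|u v Auv]; first exact: local_slope_ge0.
by apply: le_local_slope; exact: AB.
Qed.

Lemma local_slopeU A B f :
  local_slope (A `|` B) f <= Num.max (local_slope A f) (local_slope B f).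
Proof.
apply: local_slope_le => [|u v]; first by rewrite le_max local_slope_ge0.
move=> [] uv; apply: le_trans (le_local_slope f uv) _;
  by rewrite ler_wpM2r ?mdist_ge0// le_max lexx ?orbT.
Qed.

Hypothesis Mnontrivial : exists x, x != o.

Lemma lip0_mdist x : exists h, forall u v, h u - h v = mdist x u - mdist x v.
Proof.
have [|h hE] := @lip0_ex R M o (mdist x) 1.
  move=> u v; rewrite mul1r (le_trans (mdist_lipschitz _ _ _ _))//.
  by rewrite mdistxx add0r.
by exists h => u v; rewrite !hE opprB addrA subrK.
Qed.

(** Zero is the midpoint of a nonzero molecule and its opposite. *)
Lemma extreme_neq0 (m : dual (Lip0 o)) :
  extreme_point (unit_ball (dual (Lip0 o))) m -> m != 0.
Proof.
move=> [_ mext]; apply/eqP => m0; have [x xo] := Mnontrivial.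
have mo1 := norm_molecule_le1 o x o.
have mo2 : `|- molecule o x o| <= 1 by rewrite normrN.
have t01 : 0 < (2^-1 : R) < 1 by rewrite invr_gt0 invf_lt1 ?ltr1n ?ltr0n.
have [|mo0 _] := mext _ _ _ mo1 mo2 t01.
  rewrite m0 scalerN -scalerBl (_ : _ - (1 - _) = 0) ?scale0r//.
  by lra.
have [h hE] := lip0_mdist x.
have xo0 : 0 < mdist x o by rewrite mdist_gt0.
have : molecule o x o h = 0 by rewrite mo0 m0.
rewrite moleculeE hE mdistxx sub0r mulrN mulVf ?gt_eqF// => /eqP.
by rewrite oppr_eq0 oner_eq0.
Qed.

(* By [extreme_split], the sets whose complement does not norm [m] form a
   filter; any of its cluster points will do. *)
Lemma extreme_concentrated (m : dual (Lip0 o)) : compact [set: M] ->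
  extreme_point (unit_ball (dual (Lip0 o))) m ->
  exists u v : M, forall W, nbhs (u, v) W -> forall f, `|m f| <= local_slope W f.
Proof.
move=> Mcompact mext; have m1 := mext.1.
have M2c : compact [set: M * M] by rewrite -setXTT; exact: compact_setX.
pose G := [set A | ~ forall f, `|m f| <= local_slope (~` A) f].
have GF : ProperFilter G.
  split.
    move=> G0; apply: G0 => f; rewrite setC0.
    apply: le_trans (dualE_norm m f) _; apply: (@le_trans _ _ `|f|).
      by rewrite ler_piMl.
    by apply: norm_lip0_le => [|u v]; [exact: local_slope_ge0|exact: le_local_slope].
  split.
  - move=> GT; move/eqP: (extreme_neq0 mext); apply.
    apply/val_inj/funext => f /=; apply/eqP; rewrite -normr_le0.
    apply: le_trans (GT f) _; apply: local_slope_le => // u v; rewrite setCT.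
    by [].
  - move=> A B GA GB; rewrite /G/= setCI => GAB.
    have [] := extreme_split mext (local_slope_seminorm (~` A))
      (local_slope_seminorm (~` B)) (local_slope_norm _) (local_slope_norm _).
    + by move=> f; apply: le_trans (GAB f) _; exact: local_slopeU.
    + exact: GA.
    + exact: GB.
  - move=> A B AB GA GB; apply: GA => f; apply: le_trans (GB f) _.
    by apply: local_slope_sub; exact: subsetC.
have [[u v] [_ cl]] := M2c G GF filterT.
exists u, v => W Wuv; apply: contrapT => nW.
have GW : G (~` W) by rewrite /G/= setCK.
by have [z []] := cl _ _ GW Wuv.
Qed.

(** Slopes are continuous off the diagonal, so shrinking [W] bounds [m] by the molecule. The kernel
    of the molecule then lies in that of [m]. *)
Lemma concentrated_molecule (m : dual (Lip0 o)) (u v : M) : u != v ->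
  (forall W, nbhs (u, v) W -> forall f, `|m f| <= local_slope W f) ->
  exists c : R, `|c| <= 1 /\ m = c *: molecule o u v.
Proof.
move=> uv mW.
have D0 : 0 < mdist u v by rewrite mdist_gt0.
have mle f : `|m f| <= `|molecule o u v f|.
  apply/ler_addgt0Pr => e e0.
  have fc : {for (u, v), continuous (fun p : M * M => `|f p.1 - f p.2| / mdist p.1 p.2)}.
    have fcont : continuous (f : M -> R).
      move=> x; apply/cvgrPdist_lt => d d0.
      have k0 : 0 < d / (`|f| + 1) by rewrite divr_gt0// ltr_wpDl.
      near=> y; apply: le_lt_trans (norm_lip0 _ _ _) _.
      have : mdist x y < d / (`|f| + 1) by near: y; exact: nbhs_mdist.
      rewrite ltr_pdivlMr ?ltr_wpDl//; have := mdist_ge0 x y; lra.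
    apply: cvgM.
      apply: cvg_norm; apply: cvgB.
        by apply: continuous_comp; [exact: cvg_fst|exact: fcont].
      by apply: continuous_comp; [exact: cvg_snd|exact: fcont].
    by apply: cvgV; [rewrite gt_eqF|exact: mdist_continuous].
  move/cvgrPdist_lt : fc => /(_ _ e0) fW.
  apply: le_trans (mW _ fW f) _; apply: local_slope_le => [|x y /=].
    by rewrite addr_ge0// ltW.
  have [->|xy] := eqVneq x y.
    by rewrite subrr normr0 mdistxx mulr0.
  have -> : `|molecule o u v f| = `|f u - f v| / mdist u v.
    by rewrite moleculeE normrM mulrC [`|(mdist _ _)^-1|]gtr0_norm// invr_gt0.
  rewrite ltr_norml => /andP[lt _]; rewrite -ler_pdivrMr ?mdist_gt0//.
  by lra.
have [h0 h0E] := lip0_mdist v.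
have mh0 : molecule o u v h0 = 1.
  by rewrite moleculeE h0E mdistxx subr0 (metric_sym v) mulVf// gt_eqF.
exists (m h0); split; first by rewrite (le_trans (mle _))// mh0 normr1.
apply/val_inj/funext => f /=.
have := mle (f - molecule o u v f *: h0).
rewrite !dual_subE !dual_scaleE mh0 mulr1 subrr normr0 normr_le0 subr_eq0.
by move=> /eqP ->; rewrite mulrC.
Unshelve. all: by end_near. Qed.

(** The molecule is a convex combination of those of [(u, z)] and [(z, v)], weighted by length. The
    distance to [z] has slopes 1 and -1 there, so extremality would force [c = 0]. *)
Lemma molecule_not_extreme (u v : M) (c : R) : metrically_convex M -> u != v ->
  `|c| <= 1 -> ~ extreme_point (unit_ball (dual (Lip0 o))) (c *: molecule o u v).
Proof.
move=> conv uv c1 mext; have [z [uzv zuv]] := conv _ _ uv.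
rewrite /metric_segment/= in uzv.
have D0 : 0 < mdist u v by rewrite mdist_gt0.
have uz : 0 < mdist u z by rewrite mdist_gt0; apply/eqP => E; apply: zuv; left.
have zv : 0 < mdist z v by rewrite mdist_gt0; apply/eqP => E; apply: zuv; right.
pose t := mdist u z / mdist u v.
have t01 : 0 < t < 1.
  by rewrite divr_gt0//= ltr_pdivrMr// mul1r -uzv ltrDl.
have ball x y : unit_ball (dual (Lip0 o)) (c *: molecule o x y).
  by rewrite /unit_ball/= normrZ mulr_ile1//; exact: norm_molecule_le1.
have [|uzE zvE] := mext.2 (c *: molecule o u z) (c *: molecule o z v) t
  (ball _ _) (ball _ _) t01.
  apply/val_inj/funext => f /=.
  rewrite -[LHS]/(c * molecule o u v f).
  rewrite -[RHS]/(t * (c * molecule o u z f) + (1 - t) * (c * molecule o z v f)).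
  rewrite !moleculeE /t; have -> : mdist u v = mdist u z + mdist z v by [].
  by field; rewrite !gt_eqF//; lra.
have [h hE] := lip0_mdist z.
have h1 : molecule o u z h = 1.
  by rewrite moleculeE hE mdistxx subr0 (metric_sym z) mulVf// gt_eqF.
have h2 : molecule o z v h = -1.
  by rewrite moleculeE hE mdistxx sub0r mulrN mulVf// gt_eqF.
have : (c *: molecule o u z) h = (c *: molecule o z v) h by rewrite uzE zvE.
rewrite (dualZ c (molecule o u z)) (dualZ c (molecule o z v)) h1 h2 => cc; have c0 : c = 0 by lra.
by move/eqP: (extreme_neq0 mext); apply; rewrite c0 scale0r.
Qed.

(* A function can be made constant near [u] without changing its values at
   finitely many given points and with at most twice the norm. *)
Lemma concentrated_diagonal_eq0 (m : FreeSpace o) (u : M) :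
  (forall W, nbhs (u, u) W -> forall f, `|free_val m f| <= local_slope W f) ->
  free_val m = 0.
Proof.
move=> mW; apply/val_inj/funext => f /=.
apply/eqP; rewrite -normr_le0; apply/ler_addgt0Pr => e e0; rewrite add0r.
have : closure (lin_span (range (delta o))) (free_val m).
  by case: m {mW} => m /=; rewrite inE.
(* The 3 accounts for [f] and for the modified function [g], of at most twice its norm. *)
have k0 : 0 < e / (3 * `|f| + 1) by rewrite divr_gt0// ltr_wpDl// mulr_ge0.
move=> /(_ _ (nbhsx_ballx _ _ k0))[_ [[d [a [w [wd ->]]]]]].
rewrite -ball_normE /=; set mu := \sum_(i < d) _ => mmu.
have wx i : exists x, w i = delta o x by have [x _ <-] := wd i; exists x.
have [xs xsE] := choice wx.
have [r r0 rP] : exists2 r : R, 0 < r &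
    forall x, x \in o :: [seq xs i | i <- enum 'I_d] -> x = u \/ 2 * r <= mdist u x.
  elim: (o :: _) => [|x s [r r0 rP]]; first by exists 1.
  have [->|xu] := eqVneq x u.
    by exists r => // y; rewrite inE => /predU1P[->|/rP]; [left|].
  have ux : 0 < mdist u x by rewrite mdist_gt0 eq_sym.
  exists (Num.min r (mdist u x / 2)); first by rewrite lt_min r0 divr_gt0.
  move=> y; rewrite inE => /predU1P[->|/rP[|ry]]; [right| by left|right].
    have : Num.min r (mdist u x / 2) <= mdist u x / 2 by rewrite ge_min lexx orbT.
    by lra.
  have : Num.min r (mdist u x / 2) <= r by rewrite ge_min lexx.
  by lra.
pose A := [set z | mdist u z < r] `|` [set z | 2 * r <= mdist u z].
pose phi z : R := if mdist u z < r then f u else f z.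
have n2 : 0 <= 2 * `|f| by rewrite mulr_ge0.
(* The gap between the radii [r] and [2 * r] makes [mdist z y] at least half of [mdist u y], whence
   the factor 2. *)
have far z y : mdist u z < r -> 2 * r <= mdist u y ->
    `|f u - f y| <= 2 * `|f| * mdist z y.
  move=> uz uy; apply: le_trans (norm_lip0 _ _ _) _.
  rewrite (mulrC 2) -mulrA ler_wpM2l//.
  by have := metric_triangle u z y; lra.
have [||F [Flip FA]] := @lipschitz_extension R M A phi (2 * `|f|) _ n2.
- by exists u; left; rewrite /= mdistxx.
- move=> x y Ax Ay; rewrite /phi.
  have F2 : 0 <= 2 * `|f| * mdist x y by rewrite mulr_ge0 ?mdist_ge0.
  case: ltP => ux; case: ltP => uy.
  + by rewrite subrr normr0.
  + by apply: far => //; case: Ay => //=; rewrite ltNge uy.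
  + rewrite distrC metric_sym.
    by apply: far => //; case: Ax => //=; rewrite ltNge ux.
  + apply: le_trans (norm_lip0 _ _ _) _; rewrite -mulrA; have := norm_lip0 f x y.
    have : 0 <= `|f| * mdist x y by rewrite mulr_ge0 ?mdist_ge0.
    lra.
have [g gE] := lip0_ex o Flip.
have Fxs x : x \in o :: [seq xs i | i <- enum 'I_d] -> F x = f x.
  move=> /rP[->|ux]; first by rewrite FA /phi; [case: ifP|left; rewrite /= mdistxx].
  rewrite FA; last by right.
  by rewrite /phi ltNge (le_trans _ ux)//; lra.
have gf i : g (xs i) = f (xs i).
  rewrite gE !Fxs ?mem_head//; last first.
    by rewrite inE map_f ?orbT// mem_enum.
  by rewrite lip0_base subr0.
have mug : mu g = mu f.
  have muE h : mu h = \sum_(i < d) a i * h (xs i).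
    rewrite /mu (big_morph (fun L : dual (Lip0 o) => L h) (id1 := 0) (op1 := +%R))//.
    by apply: eq_bigr => i _; rewrite xsE.
  by rewrite !muE; apply: eq_bigr => i _; rewrite gf.
have gnorm : `|g| <= 2 * `|f|.
  by apply: norm_lip0_le => // x y; rewrite !gE opprB addrA subrK.
have mg0 : free_val m g = 0.
  apply/eqP; rewrite -normr_le0.
  pose W := [set z | mdist u z < r] `*` [set z | mdist u z < r].
  have uW : nbhs (u, u) W.
    by exists ([set z | mdist u z < r], [set z | mdist u z < r]) => //;
      split; exact: nbhs_mdist.
  apply: le_trans (mW _ uW g) _; apply: local_slope_le => // x y [/= xr yr].
  rewrite !gE opprB addrA subrK (FA x (or_introl xr)) (FA y (or_introl yr)).
  by rewrite /phi xr yr subrr normr0 mul0r.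
(* [mu] does not distinguish [f] from [g], and [m] vanishes at [g], which is constant near [u]. *)
have -> : free_val m f = (free_val m - mu) f - (free_val m - mu) g.
  by rewrite !dualB mg0 mug; lra.
apply: le_trans (ler_normB _ _) _.
have := dualE_norm (free_val m - mu) f; have := dualE_norm (free_val m - mu) g.
move: mmu; rewrite ltr_pdivlMr ?ltr_wpDl ?mulr_ge0//.
have : `|free_val m - mu| * `|g| <= `|free_val m - mu| * (2 * `|f|) by rewrite ler_wpM2l.
have := normr_ge0 (free_val m - mu); lra.
Qed.

Lemma not_preserved_extreme (m : FreeSpace o) : metrically_convex M ->
  compact [set: M] -> ~ preserved_extreme_point m.
Proof.
move=> conv Mcompact mext.
have [u [v mW]] := extreme_concentrated Mcompact mext.
have [uv|uv] := eqVneq u v.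
  rewrite uv in mW; move/eqP: (extreme_neq0 mext); apply.
  exact: concentrated_diagonal_eq0 mW.
have [c [c1 mE]] := concentrated_molecule uv mW.
rewrite /preserved_extreme_point mE in mext.
exact: molecule_not_extreme conv uv c1 mext.
Qed.

End preserved_extreme_points.

(** * The cycle of implications *)

Theorem corollary4p11 (R : realType) (M : metricType R) (o : M)
    (Mcompact : compact [set: M]) (Mnontrivial : exists x : M, x != o) :
  [<->
    (* i   *) geodesic M;
    (* ii  *) forall x y : M, x != y ->
                (metric_segment x y `\` [set x; y]) !=set0;
    (* iii *) daugavet_property (Lip0 o);
    (* iv  *) ~ exists m : FreeSpace o, preserved_extreme_point m;
    (* v   *) ~ exists m : FreeSpace o, strongly_exposed_point m;
    (* vi  *) ~ exists f : Lip0 o, gateaux_differentiable (norm_fun (Lip0 o)) f;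
    (* vii *) ~ exists f : Lip0 o, differentiable (norm_fun (Lip0 o)) f].
Proof.
rewrite -/(metrically_convex M).
have seg := metrically_convex_segments Mcompact.
(* Common contrapositive of the ways back to (ii): without convexity the norm is affine near some
   [f], which refutes each of (iii), (iv), (v) and (vii). *)
have convex_of (P : Prop) : (forall (x y : M) (f : Lip0 o) (eta : R),
    `|f| = 1 -> 0 < eta -> eta <= 1 ->
    (forall h, `|h| <= eta -> `|f + h| = 1 + molecule o x y h) -> ~ P) ->
    P -> metrically_convex M.
  move=> nP HP; apply: contrapT => /(isolated_pair_exists Mcompact).
  move=> [x [y [e [xy e0 e1 /(isolated_pair_affine o xy e0 e1)[f [f1 aff]]]]]].
  have e8 : 0 < e / 8 by rewrite divr_gt0.
  by apply: (nP x y f (e / 8) f1 e8 _ aff) HP; lra.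
have iii_ii : daugavet_property (Lip0 o) -> metrically_convex M.
  apply: convex_of => x y f eta f1 eta0 eta1 aff.
  exact: affine_norm_not_daugavet f1 eta0 eta1 aff (norm_molecule_le1 o x y).
have iv_ii : ~ (exists m : FreeSpace o, preserved_extreme_point m) ->
    metrically_convex M.
  apply: convex_of => x y f eta f1 eta0 _ aff; apply; exists (free_molecule o x y).
  exact: affine_norm_extreme f1 eta0 aff (norm_molecule_le1 o x y).
have v_ii : ~ (exists m : FreeSpace o, strongly_exposed_point m) ->
    metrically_convex M.
  apply: convex_of => x y f eta f1 eta0 _ aff; apply; exists (free_molecule o x y).
  exact: strongly_exposed_molecule f1 eta0 aff.
have vii_ii : ~ (exists f : Lip0 o, differentiable (norm_fun (Lip0 o)) f) ->
    metrically_convex M.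
  apply: convex_of => x y f eta f1 eta0 _ aff; apply; exists f.
  exact: affine_norm_differentiable f1 eta0 aff.
(* Every implication passes through (ii), except (vi) to (vii), where differentiability gives
   Gateaux differentiability. *)
tfae.
- exact: geodesic_metrically_convex.
- by move=> /seg segM; exact: segments_daugavet.
- by move=> /iii_ii conv [m]; exact: not_preserved_extreme.
- by move=> /iv_ii/seg segM [m]; exact: not_strongly_exposed.
- by move=> /v_ii/seg segM [f]; exact: not_gateaux.
- by move=> nG [f /differentiable_gateaux df]; apply: nG; exists f.
- by move=> /vii_ii/seg; exact: segments_geodesic.
Qed.
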